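(* Let $h\in (2^A)^{k\times \ell}$ be a voting correspondence (with associated parameters $p,\alpha,\beta$). Then one can recognize in polynomial time (in the size of $h$, i.e. in $k$, $\ell$ and $p$) whether $h$ is a DAV correspondence. If it is, one can also obtain in polynomial time a labeling of the rows and columns of $h$ by the elements of $X$ and $Y$, respectively, i.e. bijective labelings $X=\{x^1,\dots,x^k\}$, $Y=\{y^1,\dots,y^\ell\}$ with $h(i,j)=AM(x^i+y^j)$ for all $i,j$. Moreover, in that case, if $\ell\geq k$ then the labeling of the rows is unique (the same in every such pair of labelings), and otherwise the labeling of the columns is unique.
   Context: There are two voters. A voting correspondence is a matrix $h\in(2^A)^{k\times\ell}$, where $A$, the set of candidates, is the set of elements appearing in the entries of the matrix, and $p=|A|$. It is assumed that there are positive integers $\alpha,\beta$ (the numbers of voting cards of the first and second voter) with $k=\binom{\alpha+p-1}{p-1}$ and $\ell=\binom{\beta+p-1}{p-1}$. The sets of voting strategies are $X=\{x\in\mathbb{Z}_{\ge 0}^A : \sum_{a\in A}x_a=\alpha\}$ and $Y=\{y\in\mathbb{Z}_{\ge 0}^A : \sum_{a\in A}y_a=\beta\}$, so $|X|=k$, $|Y|=\ell$. For $z\in\mathbb{Z}^A$ let $AM(z)=\{a\in A : z_a=\max_{c\in A}z_c\}$. The matrix $h$ is a distributed approval voting correspondence (DAV correspondence) if the strategies can be labeled bijectively as $X=\{x^1,\dots,x^k\}$, $Y=\{y^1,\dots,y^\ell\}$ such that $h(i,j)=AM(x^i+y^j)$ for all $i=1,\dots,k$, $j=1,\dots,\ell$.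 *)

(* Defs.v *)
From mathcomp Require Import all_boot all_algebra.

Set Implicit Arguments.
Unset Strict Implicit.
Unset Printing Implicit Defensive.

Section Voting.
Variable A : finType.

(* Only applied to sums of two strategies, hence natural-valued vectors. *)
Definition AM (z : A -> nat) : {set A} := [set a | z a == \max_(c : A) z c].

Definition strategy (n : nat) (x : {ffun A -> nat}) : Prop :=
  \sum_(a : A) x a = n.

Definition bijective_labels (m n : nat) (x : 'I_m -> {ffun A -> nat}) : Prop :=
  [/\ forall i, strategy n (x i),
      injective x
    & forall z, strategy n z -> exists i, x i = z].

(* The first condition says that the set of candidates is exactly the set of
   elements occurring in the entries of the matrix.  Since [0 < #|A|], the
   subtractions below are genuine. *)
Definition voting_correspondence (alpha beta k l : nat)
    (h : 'M[{set A}]_(k, l)) : Prop :=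
  [/\ forall a : A, exists i j, a \in h i j,
      0 < #|A|,
      0 < alpha /\ 0 < beta,
      k = 'C(alpha + #|A| - 1, #|A| - 1)
    & l = 'C(beta + #|A| - 1, #|A| - 1)].

Definition DAV_labeling (alpha beta k l : nat) (h : 'M[{set A}]_(k, l))
    (x : 'I_k -> {ffun A -> nat}) (y : 'I_l -> {ffun A -> nat}) : Prop :=
  [/\ bijective_labels alpha x,
      bijective_labels beta y
    & forall i j, h i j = AM (fun a => x i a + y j a)].

Definition is_DAV (alpha beta k l : nat) (h : 'M[{set A}]_(k, l)) : Prop :=
  exists x y, DAV_labeling alpha beta h x y.

End Voting.

(* Model of computation: while-programs over a random access memory of natural numbers, i.e. a
   structured random access machine with addition and truncated subtraction as
   only arithmetic operations.  Every elementary operation has unit cost.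
   Without multiplication the bit length of the stored numbers grows at most
   linearly with the running time, so this machine and the Turing machine
   simulate each other with polynomial overhead.  The memory is presented as
   a family of arrays; an access [Get b e] or [Assign b e f] has a fixed array
   name [b], so that a program uses finitely many arrays, and a computed index
   [e].  Scalar variables are array cells with a constant index. *)

Inductive expr : Type :=
| Num of nat
| Get of nat & expr
| Add of expr & expr
| Sub of expr & expr.

Inductive com : Type :=
| Skip
| Assign of nat & expr & expr
| Seq of com & com
| If of expr & com & com
| While of expr & com.

Definition state := nat -> nat -> nat.

Fixpoint eval (s : state) (e : expr) : nat :=
  match e with
  | Num n => n
  | Get b e1 => s b (eval s e1)
  | Add e1 e2 => eval s e1 + eval s e2
  | Sub e1 e2 => eval s e1 - eval s e2
  end.

Fixpoint cost (e : expr) : nat :=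
  match e with
  | Num _ => 1
  | Get _ e1 => (cost e1).+1
  | Add e1 e2 | Sub e1 e2 => (cost e1 + cost e2).+1
  end.

Definition update (s : state) (b i v : nat) : state :=
  fun b' i' => if (b' == b) && (i' == i) then v else s b' i'.

(* [exec c s t s']: started in [s], the program [c] halts after [t] elementary
   operations in [s'].  A guard is true when its value is nonzero. *)
Inductive exec : com -> state -> nat -> state -> Prop :=
| ExecSkip s : exec Skip s 1 s
| ExecAssign b e f s :
    exec (Assign b e f) s (cost e + cost f).+1
         (update s b (eval s e) (eval s f))
| ExecSeq c1 c2 s s1 s2 t1 t2 :
    exec c1 s t1 s1 -> exec c2 s1 t2 s2 -> exec (Seq c1 c2) s (t1 + t2).+1 s2
| ExecIfTrue e c1 c2 s s1 t :
    eval s e != 0 -> exec c1 s t s1 -> exec (If e c1 c2) s (cost e + t).+1 s1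
| ExecIfFalse e c1 c2 s s1 t :
    eval s e = 0 -> exec c2 s t s1 -> exec (If e c1 c2) s (cost e + t).+1 s1
| ExecWhileTrue e c s s1 s2 t1 t2 :
    eval s e != 0 -> exec c s t1 s1 -> exec (While e c) s1 t2 s2 ->
    exec (While e c) s (cost e + t1 + t2).+1 s2
| ExecWhileFalse e c s :
    eval s e = 0 -> exec (While e c) s (cost e).+1 s.

Lemma exec_det c s t1 s1 t2 s2 :
  exec c s t1 s1 -> exec c s t2 s2 -> t1 = t2 /\ s1 = s2.
Proof.
move=> H; elim: H t2 s2 => {c s t1 s1}.
- by move=> s t2 s2 H; inversion H.
- by move=> b e f s t2 s2 H; inversion H.
- move=> c1 c2 s s1 s2 t1 t2 _ IH1 _ IH2 t3 s3 H; inversion H; subst.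
  match goal with H1 : exec c1 _ _ _ |- _ => case: (IH1 _ _ H1) => ? ? end; subst.
  by match goal with H1 : exec c2 _ _ _ |- _ => case: (IH2 _ _ H1) => ? ? end; subst.
- move=> e c1 c2 s s1 t e0 _ IH t3 s3 H; inversion H; subst; last first.
    by match goal with H1 : eval s e = 0 |- _ => rewrite H1 in e0 end.
  by match goal with H1 : exec c1 _ _ _ |- _ => case: (IH _ _ H1) => ? ? end; subst.
- move=> e c1 c2 s s1 t e0 _ IH t3 s3 H; inversion H; subst.
    by match goal with H1 : is_true (eval s e != 0) |- _ => rewrite e0 in H1 end.
  by match goal with H1 : exec c2 _ _ _ |- _ => case: (IH _ _ H1) => ? ? end; subst.
- move=> e c s s1 s2 t1 t2 e0 _ IH1 _ IH2 t3 s3 H; inversion H; subst; last first.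
    by match goal with H1 : eval _ e = 0 |- _ => rewrite H1 in e0 end.
  match goal with H1 : exec c _ _ _ |- _ => case: (IH1 _ _ H1) => ? ? end; subst.
  by match goal with H1 : exec (While e c) _ _ _ |- _ => case: (IH2 _ _ H1) => ? ? end; subst.
- move=> e c s e0 t3 s3 H; inversion H; subst => //.
  by match goal with H1 : is_true (eval _ e != 0) |- _ => rewrite e0 in H1 end.
Qed.

Section Encoding.
Variable A : finType.

(* Candidates are numbered by [enum_rank].  Array 0 starts with the parameters
   and array 1 holds the membership bits of the matrix, the bit of
   [a \in h i j] being at index [(i * l + j) * #|A| + enum_rank a].  All other
   cells are 0. *)
Definition input (alpha beta k l : nat) (h : 'M[{set A}]_(k, l)) : state :=
  fun b n =>
    match b with
    | 0 => nth 0 [:: k; l; #|A|; alpha; beta] n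
    | 1 => [exists i : 'I_k, exists j : 'I_l, exists a : A,
              (n == (i * l + j) * #|A| + enum_rank a) && (a \in h i j)]
    | _ => 0
    end.

Definition output_bit (s : state) : nat := s 2 0.

Definition output_labels (s : state) (b m : nat) (i : 'I_m) : {ffun A -> nat} :=
  [ffun a => s b (i * #|A| + enum_rank a)].

End Encoding.

(* One program and one polynomial serve all inputs.  As [0 < k + l + #|A|] on
   every voting correspondence, the bounds [c * (k + l + #|A|) ^ d] dominate
   all polynomials in [k], [l] and [#|A|]. *)
Definition halts_in_poly_time
    (dom : forall (A : finType) (alpha beta k l : nat),
             'M[{set A}]_(k, l) -> Prop)
    (post : forall (A : finType) (alpha beta k l : nat),
             'M[{set A}]_(k, l) -> state -> Prop) : Prop :=
  exists (prog : com) (c d : nat),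
    forall (A : finType) (alpha beta k l : nat) (h : 'M[{set A}]_(k, l)),
      dom A alpha beta k l h ->
      exists (t : nat) (s : state),
        [/\ exec prog (input alpha beta h) t s,
            t <= c * (k + l + #|A|) ^ d
          & post A alpha beta k l h s].

(* Main.v *)
Require Import Defs.
From mathcomp Require Import all_boot all_algebra.
From mathcomp Require Import zify.

(* Let alpha <= beta.  For a strategy x of the first voter and a candidate a,
   sum over all strategies y of the second voter the weight
   [a \in AM (x + y)] + [AM (x + y) = {a}].  These numbers can be read off any
   row labelled by x without knowing the labels of the columns, and they
   determine x: if x <> x' and a maximises x a - x' a, then a loses no weight in
   passing from x' to x, and for a suitable choice of a among the maximisers
   some y which lifts a and one other candidate to the top, with a leading by at
   most one vote, makes it win weight.  Hence the row labels are unique and are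
   found by comparing each row with all strategies; given them, the columns are
   matched with the strategies y by equality of columns, the n-th column of a
   class of equal columns taking the n-th strategy that produces it.

   The algorithm is written as a program all of whose loops are bounded by k, l
   or p.  Such programs compile to the machine with a polynomial time bound, and
   their correctness is a statement about iterated sums. *)

Set Implicit Arguments.
Unset Strict Implicit.
Unset Printing Implicit Defensive.

(** * Bounded-loop programs *)

(** A total-correctness triple with a time budget. As [T] only bounds the running time, constants
    can be rounded up freely. *)
Definition runs (c : com) (s : state) (T : nat) (Q : state -> Prop) : Prop :=
  exists t s', [/\ exec c s t s', t <= T & Q s'].

Lemma runs_weaken c s T T' (Q Q' : state -> Prop) :
  runs c s T Q -> T <= T' -> (forall s', Q s' -> Q' s') -> runs c s T' Q'.
Proof.
by move=> [t [s' [ex tT Qs']]] TT' QQ'; exists t, s'; split=> //;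
  [apply: leq_trans TT' | apply: QQ'].
Qed.

Lemma runs_assign b e f s T (Q : state -> Prop) :
  cost e + cost f < T -> Q (update s b (eval s e) (eval s f)) ->
  runs (Assign b e f) s T Q.
Proof. by move=> ltT Qs; do 2 eexists; split; first exact: ExecAssign. Qed.

Lemma runs_seq c1 c2 s T1 T2 T (Q1 Q : state -> Prop) :
  runs c1 s T1 Q1 -> (forall s1, Q1 s1 -> runs c2 s1 T2 Q) ->
  T1 + T2 < T -> runs (Seq c1 c2) s T Q.
Proof.
move=> [t1 [s1 [ex1 le1 Q1s1]]] /(_ s1 Q1s1)[t2 [s2 [ex2 le2 Qs2]]] ltT.
exists (t1 + t2).+1, s2; split=> //; first exact: ExecSeq ex1 ex2.
by apply: leq_trans ltT; rewrite ltnS leq_add.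
Qed.

Lemma runs_if e c1 c2 s T0 T (Q : state -> Prop) :
  runs (if eval s e != 0 then c1 else c2) s T0 Q -> cost e + T0 < T ->
  runs (If e c1 c2) s T Q.
Proof.
move=> + ltT; case: ifPn => [e0|/negPn/eqP e0] [t [s' [ex le Qs']]];
  exists (cost e + t).+1, s'; split=> //; try by
  apply: leq_trans ltT; rewrite ltnS leq_add2l.
- exact: ExecIfTrue.
- exact: ExecIfFalse.
Qed.

Definition upd (f : nat -> nat) (v n : nat) : nat -> nat :=
  fun w => if w == v then n else f w.

(** Arrays 0 and 1 hold the input, 2 to 4 the output, 5 and 6 the tables of strategies; 7 is scratch
    space. *)
Definition tmp := 7.

(** Truncated subtraction makes the guard nonzero exactly while the counter is below the bound. *)
Definition for_com (d r : nat) (c : com) : com :=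
  Seq (Assign tmp (Defs.Num d) (Defs.Num 0))
      (While (Defs.Sub (Get 0 (Defs.Num r)) (Get tmp (Defs.Num d)))
         (Seq c (Assign tmp (Defs.Num d) (Add (Get tmp (Defs.Num d)) (Defs.Num 1))))).

Lemma runs_for d r c s n T B (I : nat -> state -> Prop) :
  s 0 r = n -> I 0 (update s tmp d 0) ->
  (forall i s', i < n -> s' 0 r = n -> s' tmp d = i -> I i s' ->
     runs c s' B (fun s1 => [/\ s1 0 r = n, s1 tmp d = i
                              & I i.+1 (update s1 tmp d i.+1)])) ->
  n * (B + 20) + 20 <= T ->
  runs (for_com d r c) s T (fun s' => I n s').
Proof.
move=> sn I0 step leT.
apply: (@runs_seq _ _ _ 3 (n * (B + 20) + 6) _
         (fun s' => [/\ s' 0 r = n, s' tmp d = 0 & I 0 s'])); last by lia.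
  by apply: runs_assign => //; split=> //; rewrite /update /= eqxx.
(* Induction on the number [m] of iterations left; the final 6 pays for the failing guard. *)
suff loop m i s1 : i <= n -> n - i = m ->
    [/\ s1 0 r = n, s1 tmp d = i & I i s1] ->
    runs (While (Defs.Sub (Get 0 (Defs.Num r)) (Get tmp (Defs.Num d)))
      (Seq c (Assign tmp (Defs.Num d) (Add (Get tmp (Defs.Num d)) (Defs.Num 1)))))
      s1 (m * (B + 20) + 6) (fun s' => I n s').
  by move=> s1; apply: loop => //; rewrite subn0.
elim: m i s1 => [|m IH] i s1 lein En [s1r s1d Ii].
  exists 6, s1; split=> //.
    by apply: (@ExecWhileFalse (Defs.Sub _ _)) => /=; rewrite s1r s1d; lia.
  by have -> : n = i by lia.
have ltin : i < n by lia.
have [t [s2 [ex le [s2r s2d Ii1]]]] := step i s1 ltin s1r s1d Ii.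
have [||t' [s3 [ex' le' Q3]]] := IH i.+1 (update s2 tmp d i.+1) ltin; first lia.
  by split=> //; rewrite /update /= !eqxx.
exists ((5 + (t + 6).+1) + t').+1, s3; split=> //; last by rewrite mulSn; lia.
apply: (@ExecWhileTrue (Defs.Sub _ _) _ s1 (update s2 tmp d i.+1)).
- by rewrite /= s1r s1d; lia.
- apply: ExecSeq ex _.
  have := ExecAssign tmp (Defs.Num d) (Add (Get tmp (Defs.Num d)) (Defs.Num 1)) s2.
  by rewrite /= s2d -(addn1 i).
- exact: ex'.
Qed.

(** * Expressions with bounded sums and their compilation *)

Inductive xexp : Type :=
| XNum of nat
| XVar of nat
| XGet of nat & xexp
| XAdd of xexp & xexp
| XSub of xexp & xexp
| XIf of xexp & xexp & xexp
| XSum of nat & nat & xexp.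

Fixpoint xeval (s : state) (rho : nat -> nat) (e : xexp) : nat :=
  match e with
  | XNum n => n
  | XVar v => rho v
  | XGet b e1 => s b (xeval s rho e1)
  | XAdd e1 e2 => xeval s rho e1 + xeval s rho e2
  | XSub e1 e2 => xeval s rho e1 - xeval s rho e2
  | XIf e0 e1 e2 =>
      if xeval s rho e0 != 0 then xeval s rho e1 else xeval s rho e2
  | XSum v r e1 => \sum_(i < s 0 r) xeval s (upd rho v i) e1
  end.

(** The condition [r < 3] restricts the ranges of sums to k, l and p. The numbers of cards are
    excluded: for p = 1 the size of the matrix does not bound them. *)
Fixpoint xwf (e : xexp) : bool :=
  match e with
  | XNum _ | XVar _ => true
  | XGet b e1 => (b != tmp) && xwf e1
  | XAdd e1 e2 | XSub e1 e2 => xwf e1 && xwf e2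
  | XIf e0 e1 e2 => [&& xwf e0, xwf e1 & xwf e2]
  | XSum _ r e1 => (r < 3) && xwf e1
  end.

(** A stack discipline: the value goes to scratch cell [d], and the cells below are preserved. In a
    sum, [d] accumulates, [d.+1] is the counter and thus the bound variable, and [d.+2] receives the
    summand. *)
Fixpoint xcomp (delta : nat -> nat) (d : nat) (e : xexp) : com :=
  match e with
  | XNum n => Assign tmp (Defs.Num d) (Defs.Num n)
  | XVar v => Assign tmp (Defs.Num d) (Get tmp (Defs.Num (delta v)))
  | XGet b e1 =>
      Seq (xcomp delta d e1)
          (Assign tmp (Defs.Num d) (Get b (Get tmp (Defs.Num d))))
  | XAdd e1 e2 =>
      Seq (xcomp delta d e1) (Seq (xcomp delta d.+1 e2)
        (Assign tmp (Defs.Num d)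
           (Add (Get tmp (Defs.Num d)) (Get tmp (Defs.Num d.+1)))))
  | XSub e1 e2 =>
      Seq (xcomp delta d e1) (Seq (xcomp delta d.+1 e2)
        (Assign tmp (Defs.Num d)
           (Defs.Sub (Get tmp (Defs.Num d)) (Get tmp (Defs.Num d.+1)))))
  | XIf e0 e1 e2 =>
      Seq (xcomp delta d e0)
          (If (Get tmp (Defs.Num d)) (xcomp delta d e1) (xcomp delta d e2))
  | XSum v r e1 =>
      Seq (Assign tmp (Defs.Num d) (Defs.Num 0))
        (for_com d.+1 r (Seq (xcomp (upd delta v d.+1) d.+2 e1)
           (Assign tmp (Defs.Num d)
              (Add (Get tmp (Defs.Num d)) (Get tmp (Defs.Num d.+2))))))
  end.

Definition frame (d : nat) (s s' : state) : Prop :=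
  forall b i, (b != tmp) || (i < d) -> s' b i = s b i.

Lemma eq_xeval d s s' rho rho' e :
  xwf e -> frame d s s' -> rho' =1 rho -> xeval s' rho' e = xeval s rho e.
Proof.
move=> + fr; elim: e rho rho' => //=.
- by move=> b e IH rho rho' /andP[bt we] Er; rewrite (IH rho) // fr ?bt.
- by move=> e1 IH1 e2 IH2 rho rho' /andP[w1 w2] Er;
    rewrite (IH1 rho) // (IH2 rho).
- by move=> e1 IH1 e2 IH2 rho rho' /andP[w1 w2] Er;
    rewrite (IH1 rho) // (IH2 rho).
- by move=> e0 IH0 e1 IH1 e2 IH2 rho rho' /and3P[w0 w1 w2] Er;
    rewrite (IH0 rho) // (IH1 rho) // (IH2 rho).
- move=> v r e IH rho rho' /andP[_ we] Er; rewrite fr //.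
  by apply: eq_bigr => i _; apply: IH => // w; rewrite /upd Er.
Qed.

Lemma xeval_frame d s s' rho e :
  xwf e -> frame d s s' -> xeval s' rho e = xeval s rho e.
Proof. by move=> we fr; apply: eq_xeval we fr _. Qed.

(** With the next lemma: bounds of the form [c * N ^ k] are closed under sequencing and under loops
    of at most [N] rounds, the constants absorbing the bookkeeping. *)
Lemma leq_pow_bound N c1 k1 c2 k2 C :
  0 < N -> c1 * N ^ k1 + c2 * N ^ k2 + C <= (c1 + c2 + C) * N ^ (k1 + k2).
Proof.
move=> N0; rewrite !mulnDl.
have le1 m : 0 < N ^ m by rewrite expn_gt0 N0.
rewrite !leq_add ?leq_mul ?leq_pexp2l ?leq_addr ?leq_addl //.
by rewrite leq_pmulr.
Qed.

Lemma leq_loop_bound N n c k :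
  0 < N -> n <= N ->
  n * (c * N ^ k + 40) + 40 <= (c + 80) * N ^ k.+1.
Proof.
move=> N0 nN; have : 0 < N ^ k by rewrite expn_gt0 N0.
rewrite expnS; nia.
Qed.

Definition sizes_bounded (N : nat) (s : state) : Prop :=
  0 < N /\ forall r, r < 3 -> s 0 r <= N.

(* Variable [v] is kept in cell [delta v] of the scratch array, whose cells from
   [d] on are free. *)
Definition holds (s : state) (delta : nat -> nat) (d : nat) (rho : nat -> nat) :
    Prop :=
  forall v, delta v < d /\ s tmp (delta v) = rho v.

Lemma frame_trans d d' s s1 s2 :
  d <= d' -> frame d s s1 -> frame d' s1 s2 -> frame d s s2.
Proof.
move=> dd' f1 f2 b i bi; rewrite f2 ?f1 //.
by case/orP: bi => [->//|id]; rewrite (leq_trans id) ?orbT.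
Qed.

Lemma frame_update d d' s s1 v :
  d <= d' -> frame d s s1 -> frame d s (update s1 tmp d' v).
Proof.
move=> dd' f b i bi; rewrite /update; case: ifP => [/andP[/eqP bt /eqP id]|_].
  by move: bi; rewrite bt eqxx id ltnNge dd'.
exact: f.
Qed.

Lemma frame_bounded N d s s1 :
  frame d s s1 -> sizes_bounded N s -> sizes_bounded N s1.
Proof. by move=> f [N0 sN]; split=> // r r3; rewrite f ?sN. Qed.

Lemma frame_holds delta d d' rho s s1 : d <= d' ->
  frame d s s1 -> holds s delta d rho -> holds s1 delta d' rho.
Proof.
move=> dd' f hol v; have [lt E] := hol v.
by rewrite (leq_trans lt) // f // lt orbT.
Qed.

Lemma holds_upd delta d d' rho s v n : d <= d' ->
  holds s delta d rho -> s tmp d' = n ->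
  holds s (upd delta v d') d'.+1 (upd rho v n).
Proof.
move=> dd' hol sd w; rewrite /upd; case: eqP => // _.
by have [lt E] := hol w; split=> //; apply: leq_trans lt _; apply: leq_trans dd' _.
Qed.

Lemma updateE s b i v : update s b i v b i = v.
Proof. by rewrite /update !eqxx. Qed.

(** [c] and [k] depend on the expression alone, being chosen before the sizes and the state; each
    enclosing sum raises the exponent by one. *)
Lemma xcomp_correct e : xwf e -> exists c k, forall N delta d rho s,
  sizes_bounded N s -> holds s delta d rho ->
  runs (xcomp delta d e) s (c * N ^ k)
    (fun s' => s' tmp d = xeval s rho e /\ frame d s s').
Proof.
have binop (op : expr -> expr -> expr) (opn : nat -> nat -> nat) e1 e2 :
    (forall s a b, eval s (op a b) = opn (eval s a) (eval s b)) ->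
    (forall a b, cost (op a b) = (cost a + cost b).+1) ->
    xwf e2 ->
    (exists c k, forall N delta d rho s,
      sizes_bounded N s -> holds s delta d rho ->
      runs (xcomp delta d e1) s (c * N ^ k)
        (fun s' => s' tmp d = xeval s rho e1 /\ frame d s s')) ->
    (exists c k, forall N delta d rho s,
      sizes_bounded N s -> holds s delta d rho ->
      runs (xcomp delta d e2) s (c * N ^ k)
        (fun s' => s' tmp d = xeval s rho e2 /\ frame d s s')) ->
    exists c k, forall N delta d rho s,
      sizes_bounded N s -> holds s delta d rho ->
      runs (Seq (xcomp delta d e1) (Seq (xcomp delta d.+1 e2)
        (Assign tmp (Defs.Num d)
           (op (Get tmp (Defs.Num d)) (Get tmp (Defs.Num d.+1))))))
        s (c * N ^ k)
        (fun s' => s' tmp d = opn (xeval s rho e1) (xeval s rho e2) /\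
                   frame d s s').
  move=> opE opC w2 [c1 [k1 H1]] [c2 [k2 H2]].
  exists (c1 + c2 + 20), (k1 + k2) => N delta d rho s sb hol.
  have [N0 _] := sb.
  apply: (runs_seq (T2 := c2 * N ^ k2 + 19) (H1 _ _ _ _ _ sb hol)); last first.
    by have := leq_pow_bound c1 k1 c2 k2 20 N0; lia.
  move=> s1 [E1 f1].
  have hol1 := frame_holds (leqnSn d) f1 hol.
  apply: (runs_seq (T2 := 10) (H2 _ _ _ _ _ (frame_bounded f1 sb) hol1));
    last by lia.
  move=> s2 [E2 f2]; apply: runs_assign => /=; first by rewrite opC.
  rewrite updateE opE /= E2 f2 ?ltnS ?leqnn ?orbT // E1; split.
    by rewrite (xeval_frame _ w2 f1).
  by apply: frame_update => //; apply: frame_trans f1 f2.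
elim: e => /=.
- move=> n _; exists 10, 0 => N delta d rho s _ _.
  by apply: runs_assign => //=; rewrite updateE; split=> //; apply: frame_update.
- move=> v _; exists 10, 0 => N delta d rho s _ hol.
  apply: runs_assign => //=; rewrite updateE (hol v).2.
  by split=> //; apply: frame_update.
- move=> b e IH /andP[bt /IH[c [k H]]].
  exists (c + 0 + 20), (k + 0) => N delta d rho s sb hol; have [N0 _] := sb.
  apply: (runs_seq (T2 := 10) (H _ _ _ _ _ sb hol)); last first.
    by have := leq_pow_bound c k 0 0 20 N0; lia.
  move=> s1 [E1 f1]; apply: runs_assign => //=; rewrite updateE E1 f1 ?bt //.
  by split=> //; apply: frame_update.
- move=> e1 IH1 e2 IH2 /andP[w1 w2].
  exact: (binop Add addn _ _ _ _ w2 (IH1 w1) (IH2 w2)).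
- move=> e1 IH1 e2 IH2 /andP[w1 w2].
  exact: (binop Defs.Sub subn _ _ _ _ w2 (IH1 w1) (IH2 w2)).
- move=> e0 IH0 e1 IH1 e2 IH2 /and3P[w0 w1 w2].
  have [c0 [k0 H0]] := IH0 w0; have [c1 [k1 H1]] := IH1 w1.
  have [c2 [k2 H2]] := IH2 w2.
  exists (c0 + (c1 + c2 + 0) + 20), (k0 + (k1 + k2)) => N delta d rho s sb hol.
  have [N0 _] := sb.
  have b12 := leq_pow_bound c1 k1 c2 k2 0 N0.
  have b012 := leq_pow_bound c0 k0 (c1 + c2 + 0) (k1 + k2) 20 N0.
  apply: (runs_seq (T2 := c1 * N ^ k1 + c2 * N ^ k2 + 10)
           (H0 _ _ _ _ _ sb hol)); last by lia.
  move=> s1 [E1 f1].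
  have sb1 := frame_bounded f1 sb; have hol1 := frame_holds (leqnn d) f1 hol.
  apply: (runs_if (T0 := c1 * N ^ k1 + c2 * N ^ k2)) => /=; last by lia.
  rewrite E1; case: ifP => _.
    apply: runs_weaken (H1 _ _ _ _ _ sb1 hol1) _ _; first by lia.
    move=> s2 [E2 f2]; rewrite E2 (xeval_frame _ w1 f1).
    by split=> //; apply: frame_trans f1 f2.
  apply: runs_weaken (H2 _ _ _ _ _ sb1 hol1) _ _; first by lia.
  move=> s2 [E2 f2]; rewrite E2 (xeval_frame _ w2 f1).
  by split=> //; apply: frame_trans f1 f2.
- move=> v r e IH /andP[r3 we]; have [c [k H]] := IH we.
  exists (c + 80), k.+1 => N delta d rho s sb hol; have [N0 sN] := sb.
  have bnd := leq_loop_bound c k N0 (sN r r3).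
  apply: (@runs_seq _ _ _ 10 (s 0 r * (c * N ^ k + 40) + 20) _
            (fun s1 => s1 tmp d = 0 /\ frame d s s1)); last by lia.
    by apply: runs_assign => //=; rewrite updateE; split=> //; apply: frame_update.
  move=> s1 [E1 f1].
  (* Invariant: cell [d] holds the partial sum, and nothing outside the free scratch cells has
     changed. *)
  apply: (@runs_for _ _ _ _ (s 0 r) _ (c * N ^ k + 20)
     (fun i s' => s' tmp d = \sum_(j < i) xeval s (upd rho v j) e /\
                  frame d s s')).
  + by rewrite f1.
  + rewrite big_ord0; split; last exact: frame_update.
    by rewrite /update (ltn_eqF (ltnSn d)) andbF.
  + move=> i s' iN s'r s'd [E' f'].
    have hol' : holds s' (upd delta v d.+1) d.+2 (upd rho v i).
      exact: (holds_upd v (leqnSn d) (frame_holds (leqnn d) f' hol) s'd).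
    apply: (runs_seq (T2 := 10) (H _ _ _ _ _ (frame_bounded f' sb) hol'));
      last by lia.
    move=> s2 [E2 f2]; apply: runs_assign => //=.
    have f2' : frame d s s2 by apply: frame_trans f' f2; lia.
    split.
    * by rewrite /update /= f2'.
    * by rewrite /update (gtn_eqF (ltnSn d)) andbF f2 ?ltnS ?leqnn ?orbT.
    rewrite {1}/update (ltn_eqF (ltnSn d)) andbF updateE E2 f2 ?ltnS ?leqnSn ?orbT //.
    rewrite E' big_ord_recr /= (xeval_frame _ we f'); split=> //.
    by do 2 apply: frame_update => //.
  by lia.
Qed.

(** * Statements with bounded loops and their compilation *)

Inductive stmt : Type :=
| SStore of nat & xexp & xexp
| SSeq of stmt & stmt
| SCond of xexp & stmt & stmt
| SFor of nat & nat & stmt.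

Fixpoint sden (c : stmt) (rho : nat -> nat) (s : state) : state :=
  match c with
  | SStore b e f => update s b (xeval s rho e) (xeval s rho f)
  | SSeq c1 c2 => sden c2 rho (sden c1 rho s)
  | SCond e c1 c2 =>
      if xeval s rho e != 0 then sden c1 rho s else sden c2 rho s
  | SFor v r c1 => iteri (s 0 r) (fun i => sden c1 (upd rho v i)) s
  end.

(** Forbidding stores to array 0 keeps every loop bound constant during the run. *)
Fixpoint swf (c : stmt) : bool :=
  match c with
  | SStore b e f => [&& b != 0, b != tmp, xwf e & xwf f]
  | SSeq c1 c2 => swf c1 && swf c2
  | SCond e c1 c2 => [&& xwf e, swf c1 & swf c2]
  | SFor _ r c1 => (r < 3) && swf c1
  end.

Fixpoint scomp (delta : nat -> nat) (d : nat) (c : stmt) : com :=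
  match c with
  | SStore b e f =>
      Seq (xcomp delta d e) (Seq (xcomp delta d.+1 f)
        (Assign b (Get tmp (Defs.Num d)) (Get tmp (Defs.Num d.+1))))
  | SSeq c1 c2 => Seq (scomp delta d c1) (scomp delta d c2)
  | SCond e c1 c2 =>
      Seq (xcomp delta d e)
          (If (Get tmp (Defs.Num d)) (scomp delta d c1) (scomp delta d c2))
  | SFor v r c1 => for_com d r (scomp (upd delta v d) d.+1 c1)
  end.

(* [s] is the machine state, [s'] the state of the denotational semantics,
   in which the scratch array plays no role. *)
Definition sim (s s' : state) : Prop :=
  forall b i, b != tmp -> s b i = s' b i.

Definition tmp_frame (d : nat) (s s' : state) : Prop :=
  forall i, i < d -> s' tmp i = s tmp i.

Lemma sim_frame d s s' s1 : sim s s' -> frame d s s1 -> sim s1 s'.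
Proof. by move=> si f b i bt; rewrite f ?bt // si. Qed.

Lemma sim_xeval rho e s s' :
  xwf e -> sim s s' -> xeval s rho e = xeval s' rho e.
Proof.
move=> we si; apply: (@xeval_frame 0) => // b i.
by rewrite orbF; apply: si.
Qed.

Lemma tmp_holds delta d d' rho s s1 : d <= d' ->
  tmp_frame d s s1 -> holds s delta d rho -> holds s1 delta d' rho.
Proof.
by move=> dd' f hol v; have [lt E] := hol v; rewrite (leq_trans lt) // f.
Qed.

Lemma sim_bounded N s s' : sim s s' -> sizes_bounded N s' -> sizes_bounded N s.
Proof. by move=> si [N0 sN]; split=> // r r3; rewrite si ?sN. Qed.

Lemma sden_sizes c rho s r : swf c -> sden c rho s 0 r = s 0 r.
Proof.
elim: c rho s => /=.
- by move=> b e f rho s /and4P[b0 _ _ _]; rewrite /update eq_sym (negbTE b0).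
- by move=> c1 IH1 c2 IH2 rho s /andP[w1 w2]; rewrite IH2 ?IH1.
- by move=> e c1 IH1 c2 IH2 rho s /and3P[_ w1 w2]; case: ifP; rewrite ?IH1 ?IH2.
- move=> v b c IH rho s /andP[_ wc].
  by elim: (s 0 b) => //= n E; rewrite IH.
Qed.

(** Statements write outside the scratch array, so simulation of the denotation replaces the frame
    condition used for expressions. *)
Lemma scomp_correct c : swf c -> exists a k, forall N delta d rho s s',
  sizes_bounded N s' -> sim s s' -> holds s delta d rho ->
  runs (scomp delta d c) s (a * N ^ k)
    (fun s1 => sim s1 (sden c rho s') /\ tmp_frame d s s1).
Proof.
elim: c => /=.
- move=> b e f /and4P[b0 bt we wf].
  have [c1 [k1 H1]] := xcomp_correct we; have [c2 [k2 H2]] := xcomp_correct wf.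
  exists (c1 + c2 + 20), (k1 + k2) => N delta d rho s s' sb' si hol.
  have sb := sim_bounded si sb'; have [N0 _] := sb.
  apply: (runs_seq (T2 := c2 * N ^ k2 + 19) (H1 _ _ _ _ _ sb hol)); last first.
    by have := leq_pow_bound c1 k1 c2 k2 20 N0; lia.
  move=> s1 [E1 f1]; have hol1 := frame_holds (leqnSn d) f1 hol.
  apply: (runs_seq (T2 := 10) (H2 _ _ _ _ _ (frame_bounded f1 sb) hol1));
    last by lia.
  move=> s2 [E2 f2]; apply: runs_assign => //=.
  rewrite E2 f2 ?ltnS ?leqnn ?orbT // E1 !(xeval_frame _ wf f1).
  rewrite !(sim_xeval _ _ si) //.
  have f12 : frame d s s2 by apply: frame_trans f1 f2.
  split=> [b' i bt'|i id].
    by rewrite /update; case: ifP => // _; apply: (sim_frame si f12).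
  by rewrite /update eq_sym (negbTE bt) /= f12 // id orbT.
- move=> c1 IH1 c2 IH2 /andP[w1 w2].
  have [a1 [k1 H1]] := IH1 w1; have [a2 [k2 H2]] := IH2 w2.
  exists (a1 + a2 + 20), (k1 + k2) => N delta d rho s s' sb si hol.
  have [N0 sN] := sb.
  apply: (runs_seq (T2 := a2 * N ^ k2) (H1 _ _ _ _ _ _ sb si hol)); last first.
    by have := leq_pow_bound a1 k1 a2 k2 20 N0; lia.
  move=> s1 [si1 f1].
  have sb1 : sizes_bounded N (sden c1 rho s').
    by split=> // r r3; rewrite sden_sizes ?sN.
  apply: runs_weaken (H2 _ _ _ _ _ _ sb1 si1 (tmp_holds (leqnn d) f1 hol)) _ _.
    by [].
  by move=> s2 [si2 f2]; split=> // i id; rewrite f2 ?f1.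
- move=> e c1 IH1 c2 IH2 /and3P[we w1 w2].
  have [c0 [k0 H0]] := xcomp_correct we.
  have [a1 [k1 H1]] := IH1 w1; have [a2 [k2 H2]] := IH2 w2.
  exists (c0 + (a1 + a2 + 0) + 20), (k0 + (k1 + k2)) => N delta d rho s s' sb' si hol.
  have sb := sim_bounded si sb'; have [N0 _] := sb.
  have b12 := leq_pow_bound a1 k1 a2 k2 0 N0.
  have b012 := leq_pow_bound c0 k0 (a1 + a2 + 0) (k1 + k2) 20 N0.
  apply: (runs_seq (T2 := a1 * N ^ k1 + a2 * N ^ k2 + 10)
           (H0 _ _ _ _ _ sb hol)); last by lia.
  move=> s1 [E1 f1]; have hol1 := frame_holds (leqnn d) f1 hol.
  have si1 := sim_frame si f1.
  apply: (runs_if (T0 := a1 * N ^ k1 + a2 * N ^ k2)) => /=; last by lia.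
  rewrite E1 (sim_xeval _ we si); case: ifP => _.
    apply: runs_weaken (H1 _ _ _ _ _ _ sb' si1 hol1) _ _; first by lia.
    by move=> s2 [? f2]; split=> // i id; rewrite f2 // f1 // id orbT.
  apply: runs_weaken (H2 _ _ _ _ _ _ sb' si1 hol1) _ _; first by lia.
  by move=> s2 [? f2]; split=> // i id; rewrite f2 // f1 // id orbT.
- move=> v r c IH /andP[r3 wc]; have [a [k H]] := IH wc.
  exists (a + 80), k.+1 => N delta d rho s s' sb si hol; have [N0 sN] := sb.
  have bnd := leq_loop_bound a k N0 (sN r r3).
  have den_sizes i r' :
      iteri i (fun j => sden c (upd rho v j)) s' 0 r' = s' 0 r'.
    by elim: i => //= i; rewrite sden_sizes.
  apply: runs_weaken (runs_for (n := s' 0 r) (B := a * N ^ k + 20)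
     (I := fun i s1 => sim s1 (iteri i (fun j => sden c (upd rho v j)) s') /\
                  tmp_frame d s s1) _ _ _ (leqnn _)) _ _.
  + by rewrite si.
  + split=> [b i bt|i id]; rewrite /update.
      by rewrite (negbTE bt) /= si.
    by rewrite (ltn_eqF id) andbF.
  + move=> i s1 iN s1r s1d [si1 f1].
    have hol1 : holds s1 (upd delta v d) d.+1 (upd rho v i).
      exact: (holds_upd v (leqnn d) (tmp_holds (leqnn d) f1 hol) s1d).
    have sb1 : sizes_bounded N (iteri i (fun j => sden c (upd rho v j)) s').
      by split=> // r' r3'; rewrite den_sizes ?sN.
    apply: runs_weaken (H _ _ _ _ _ _ sb1 si1 hol1) _ _; first by lia.
    move=> s2 [si2 f2]; split.
    * by rewrite si2 // sden_sizes // den_sizes.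
    * by rewrite f2.
    split=> [b j bt|j jd]; rewrite /update.
      by rewrite (negbTE bt) /= si2.
    by rewrite (ltn_eqF jd) andbF f2 ?f1 // ltnS ltnW.
  + by lia.
  + by [].
Qed.

Lemma stmt_poly_time c (rho := fun=> 0) : swf c -> exists prog a k,
  forall N s, sizes_bounded N s -> (forall i, s tmp i = 0) ->
  exists t s', [/\ exec prog s t s', t <= a * N ^ k & sim s' (sden c rho s)].
Proof.
move=> wc; have [a [k H]] := scomp_correct wc.
(* All variables share scratch cell 0, which contains 0 like the environment and lies below the free
   cells. *)
exists (scomp (fun=> 0) 1 c), a, k => N s sb s0.
have [//||t [s' [ex le [si _]]]] := H N (fun=> 0) 1 rho s s sb.
  by move=> v; rewrite s0.
by exists t, s'.
Qed.

(** * Tables filled row by row *)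

(* Cell [r] of array 0 is the factor; variable 0 is reserved for products. *)
Definition xmul (e : xexp) (r : nat) : xexp := XSum 0 r e.

(* Fills array [b] as a table with rows of length [s 0 2]. *)
Definition stable (b v1 r v2 : nat) (e : xexp) : stmt :=
  SFor v1 r (SFor v2 2 (SStore b (XAdd (xmul (XVar v1) 2) (XVar v2)) e)).

Lemma stable_frame b v1 r v2 e rho s b' n :
  b' != b -> sden (stable b v1 r v2 e) rho s b' n = s b' n.
Proof.
move=> bb'; rewrite /stable /=; elim: (s 0 r) => //= i <-.
set s1 := iteri i _ s; elim: (s1 0 2) => //= j <-.
by rewrite /update (negbTE bb').
Qed.

(** The expression is evaluated while the table is being filled. It may read all cells preceding its
    own in row-major order, which permits recurrences from row to row. *)
Lemma stableP b v1 r v2 e s rho (F : nat -> nat -> nat) :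
  b != 0 -> v1 != 0 -> v2 != 0 -> v1 != v2 ->
  (forall i a s', i < s 0 r -> a < s 0 2 ->
     (forall b' n, b' != b -> s' b' n = s b' n) ->
     (forall i' a', a' < s 0 2 -> i' < i \/ (i' = i /\ a' < a) ->
        s' b (i' * s 0 2 + a') = F i' a') ->
     xeval s' (upd (upd rho v1 i) v2 a) e = F i a) ->
  forall i a, i < s 0 r -> a < s 0 2 ->
    sden (stable b v1 r v2 e) rho s b (i * s 0 2 + a) = F i a.
Proof.
move=> b0 v10 v20 v12 H /=.
(* Common invariant of both loops: the rows below [m] and the first [q] cells of row [m] are
   filled. *)
pose good m q (s' : state) :=
  (forall b' n, b' != b -> s' b' n = s b' n) /\
  (forall i' a', a' < s 0 2 -> i' < m \/ (i' = m /\ a' < q) ->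
     s' b (i' * s 0 2 + a') = F i' a').
suff row m : m <= s 0 r ->
    good m 0 (iteri m (fun i s2 => iteri (s2 0 2) (fun j s3 =>
      update s3 b (\sum_(u < s3 0 2) upd (upd (upd rho v1 i) v2 j) 0 u v1 +
                   upd (upd rho v1 i) v2 j v2)
        (xeval s3 (upd (upd rho v1 i) v2 j) e)) s2) s).
  have [_ H2] := row _ (leqnn _) => i a ilt alt.
  by apply: H2 => //; left.
elim: m => [|m IH] lem.
  by split=> // i' a' _ [//|[_ //]].
have := IH (ltnW lem); rewrite iteriS; set s1 := iteri m _ _ => g1.
have s12 : s1 0 2 = s 0 2 by apply: g1.1; rewrite eq_sym.
rewrite s12.
suff cell q : q <= s 0 2 -> good m q (iteri q (fun j s3 =>
      update s3 b (\sum_(u < s3 0 2) upd (upd (upd rho v1 m) v2 j) 0 u v1 +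
                   upd (upd rho v1 m) v2 j v2)
        (xeval s3 (upd (upd rho v1 m) v2 j) e)) s1).
  have [c1 c2] := cell _ (leqnn _); split=> // i' a' lta [].
    by rewrite ltnS leq_eqVlt => /orP[/eqP->|lt]; apply: c2 => //; [right|left].
  by case.
elim: q => [//|q IHq] leq.
have := IHq (ltnW leq); rewrite iteriS; set s2 := iteri q _ _ => -[c1 c2].
have -> : s2 0 2 = s 0 2 by apply: c1; rewrite eq_sym.
rewrite (eq_bigr (fun=> m)) => [|u _]; last first.
  by rewrite /upd (negbTE v10) (negbTE v12) eqxx.
have -> : upd (upd rho v1 m) v2 q v2 = q by rewrite /upd eqxx.
rewrite sum_nat_const card_ord H // mulnC.
split=> [b' n bb'|i' a' lta' lt].
  by rewrite /update (negbTE bb') c1.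
rewrite /update eqxx /=; case: eqP => [E|ne].
  have p0 : 0 < s 0 2 by lia.
  have Ei : i' = m.
    by have := congr1 (divn^~ (s 0 2)) E; rewrite /= !divnMDl // !divn_small ?addn0.
  by move: E; rewrite Ei => /addnI ->.
apply: c2 => //; case: lt => [|[E lt]]; first by left.
right; split=> //; move: lt; rewrite ltnS leq_eqVlt => /orP[/eqP Eq|//].
by case: ne; rewrite E Eq.
Qed.

(** * The signature of a strategy *)

Section Signature.
Variable A : finType.
Implicit Types (x y z : A -> nat) (a b c : A).

Lemma AMP z a : reflect (forall c, z c <= z a) (a \in AM z).
Proof.
rewrite inE; apply: (iffP eqP) => [-> c|max_a]; first exact: leq_bigmax.
by apply/eqP; rewrite eqn_leq leq_bigmax; apply/bigmax_leqP.
Qed.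

Lemma AM_eq1P z a :
  reflect (forall c, c != a -> z c < z a) (AM z == [set a]).
Proof.
apply: (iffP eqP) => [E c ca|max_a].
  have /AMP max_a : a \in AM z by rewrite E set11.
  rewrite ltn_neqAle max_a andbT; apply/eqP => Ezc.
  have : c \in AM z by apply/AMP => b; rewrite Ezc.
  by rewrite E inE (negbTE ca).
apply/setP => c; rewrite inE; apply/AMP/eqP => [max_c|-> b].
  by apply/eqP/negPn/negP => ca; have := max_a c ca; rewrite ltnNge max_c.
by have [->//|/max_a/ltnW] := eqVneq b a.
Qed.

Lemma eq_AM z z' : z =1 z' -> AM z = AM z'.
Proof.
by move=> E; apply/setP => a; rewrite !inE E (eq_bigr z') // => b _; rewrite E.
Qed.

Definition weight (B : {set A}) a : nat := (a \in B) + (B == [set a]).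

Definition signature l (y : 'I_l -> {ffun A -> nat}) x a : nat :=
  \sum_(j < l) weight (AM (fun c => x c + y j c)) a.

Lemma labels_perm n m (x x' : 'I_m -> {ffun A -> nat}) :
  bijective_labels n x -> bijective_labels n x' ->
  exists2 f : 'I_m -> 'I_m, injective f & forall i, x i = x' (f i).
Proof.
move=> [Sx xI _] [_ _ x'onto].
have ex i : exists j, x' j == x i.
  by have [j <-] := x'onto _ (Sx i); exists j.
exists (fun i => xchoose (ex i)) => [i j E|i]; last by rewrite (eqP (xchooseP (ex i))).
by apply: xI; rewrite -(eqP (xchooseP (ex i))) -(eqP (xchooseP (ex j))) E.
Qed.

(* Among the candidates with maximal [x b - x' b], let [a] have maximal [x a];
   if [a] does not maximise [x], then [c] is a maximiser of [x]. *)
Lemma separating_candidates x x' :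
  \sum_b x b = \sum_b x' b -> ~ x =1 x' ->
  exists a c, [/\ forall b, x' a + x b <= x a + x' b,
                  x' a + x c < x a + x' c
                & forall b, x b <= maxn (x a) (x c)].
Proof.
move=> Esum neq.
have [a0 _|no] := pickP (@predT A); last by case: neq => a; have := no a.
have lex' b : x' b <= \sum_b x' b by rewrite (bigD1 b) //= leq_addr.
pose D a := [forall b, x' a + x b <= x a + x' b].
have [a1 Da1] : exists a1, D a1.
  (* Maximise [x b - x' b], shifted by the total of [x'] to stay in the natural numbers. *)
  have [a _ max_a] := @arg_maxnP A a0 xpredT
    (fun b => x b + (\sum_b x' b - x' b)) isT.
  exists a; apply/forallP => b; have /= := max_a b isT.
  by have := lex' a; have := lex' b; lia.
have [a Da /= max_a] := @arg_maxnP A a1 D x Da1.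
have [e _ /(_ _ isT) /= max_e] := @arg_maxnP A a0 xpredT x isT.
have DaE := forallP Da.
case: (boolP (D e)) => [De|nDe]; last first.
  exists a, e; split=> // [|b]; last by rewrite leq_max max_e ?orbT.
  rewrite ltn_neqAle DaE andbT; apply: contra nDe => /eqP E.
  by apply/forallP => b; have := DaE b; lia.
(* As the maximiser [e] of [x] satisfies [D], [a] maximises [x] too, and any candidate outside [D]
   serves as [c]. *)
suff [c nDc] : exists c, ~~ D c.
  exists a, c; split=> // [|b].
    rewrite ltn_neqAle DaE andbT; apply: contra nDc => /eqP E.
    by apply/forallP => b; have := DaE b; lia.
  by rewrite leq_max (leq_trans (max_e b)) // max_a.
have [/existsP//|/existsPn allD] := boolP [exists c, ~~ D c].
case: neq.
(* If all candidates satisfy [D], then [x - x'] is constant, hence zero because the totals agree. *)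
have eq_diff b : x' a + x b = x a + x' b.
  have /negPn/forallP/(_ a) := allD b; have := DaE b; lia.
have : \sum_b (x' a + x b) = \sum_b (x a + x' b) by apply: eq_bigr.
rewrite !big_split /= !sum_nat_const Esum => /addIn /eqP.
have A0 : 0 < #|A| by apply/card_gt0P; exists a.
by rewrite eqn_pmul2l // => /eqP E b; have := eq_diff b; lia.
Qed.

(** Passing from [x'] to [x] never shrinks the margin of [a] over a rival, so [a] remains a winner,
    and the sole one if it was. *)
Lemma weight_mono x x' y a :
  (forall b, x' a + x b <= x a + x' b) ->
  weight (AM (fun c => x' c + y c)) a <= weight (AM (fun c => x c + y c)) a.
Proof.
move=> Da; apply: leq_add.
  case: AMP => //= H; case: AMP => //; case=> c.
  by have := H c; have := Da c; lia.
case: AM_eq1P => //= H; case: AM_eq1P => //; case=> c ca.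
by have := H c ca; have := Da c; lia.
Qed.

Lemma signature_inj alpha beta l (y : 'I_l -> {ffun A -> nat})
    (x x' : {ffun A -> nat}) :
  alpha <= beta \/ #|A| <= 1 -> bijective_labels beta y ->
  strategy alpha x -> strategy alpha x' ->
  (forall a, signature y x a = signature y x' a) -> x = x'.
Proof.
move=> le_ab [_ _ y_onto] Sx Sx' Esig.
case: le_ab => [le_ab|/fintype_le1P A1]; last first.
  have one (z : {ffun A -> nat}) a : \sum_b z b = z a.
    by apply: big_pred1 => b; apply/esym/eqP/(A1 a).
  by apply/ffunP => a; rewrite -!(one _ a) Sx Sx'.
apply/eqP/negPn/negP => /eqP neq.
have [||a [c [Da lt_ac max_ac]]] := @separating_candidates x x'.
- by rewrite Sx Sx'.
- by move=> E; apply: neq; apply/ffunP.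
have ca : c != a by apply: contraTneq lt_ac => ->; rewrite addnC ltnn.
have le_x b : b != a -> x b + x a <= alpha.
  move=> ba; rewrite -Sx (bigD1 a) //= (bigD1 b) //=; lia.
have xac := le_x c ca.
(* Target scores of [c] and [a]: the votes available to the two are split evenly, [a] getting the
   odd one. *)
pose h2 := (beta + x a + x c)./2; pose h1 := beta + x a + x c - h2.
have h12 : h1 = h2 \/ h1 = h2.+1.
  by rewrite /h1 /h2; have := odd_double_half (beta + x a + x c);
    case: odd => /=; lia.
(* Here [alpha <= beta] enters: from [x c + x a <= alpha] it follows that [x a + x c <= h2]. *)
have [h2a h2c] : x a <= h2 /\ x c <= h2 by split; rewrite /h2; lia.
have h1a : x a <= h1 by lia.
have sum_h : h1 + h2 = beta + x a + x c by rewrite /h1 /h2; lia.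
pose y0 := [ffun b => if b == a then h1 - x a
                      else if b == c then h2 - x c else 0].
have /y_onto[j0 y0E] : strategy beta y0.
  rewrite /strategy (bigD1 a) //= (bigD1 c) //= big1 ?addn0 => [|b].
    by rewrite !ffunE !eqxx (negbTE ca); lia.
  by rewrite ffunE => /andP[/negbTE -> /negbTE ->].
have za : x a + y0 a = h1 by rewrite ffunE eqxx; lia.
have zc : x c + y0 c = h2 by rewrite ffunE eqxx (negbTE ca); lia.
have zb b : b != a -> x b + y0 b <= h2.
  move=> ba; have [->|bc] := eqVneq b c; first by rewrite zc.
  rewrite ffunE (negbTE ba) (negbTE bc) addn0.
  by apply: leq_trans (max_ac b) _; rewrite geq_max h2a h2c.
have := Esig a; apply/eqP; rewrite gtn_eqF // /signature.
rewrite (bigD1 j0) //= [in ltnRHS](bigD1 j0) //= y0E -addSn leq_add //; last first.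
  by apply: leq_sum => j _; apply: weight_mono.
rewrite /weight.
have mono1 : (a \in AM (fun b => x' b + y0 b)) <= (a \in AM (fun b => x b + y0 b)).
  case: AMP => //= H; case: AMP => //; case=> b.
  by have := H b; have := Da b; lia.
(* Under [x'] the lead of [a] over [c] is smaller by at least one. If [h1 = h2.+1], [a] wins alone
   under [x] but not under [x']; if [h1 = h2], a shared win is lost. *)
case: h12 => h12; last first.
  rewrite -addnS leq_add //.
  have -> : AM (fun b => x b + y0 b) == [set a].
    by apply/AM_eq1P => b ba; rewrite za h12 ltnS zb.
  case: AM_eq1P => //= H; have := H c ca; lia.
rewrite -addSn leq_add //.
  have -> : a \in AM (fun b => x b + y0 b).
    by apply/AMP => b; rewrite za; have [->|/zb] := eqVneq b a; lia.
  case: AMP => //= H; have := H c; lia.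
case: AM_eq1P => //= H; case: AM_eq1P => //; case=> b ba.
by have := H b ba; have := Da b; lia.
Qed.
(** The labels of the columns are unknown, but only their set matters, so any enumeration of the
    strategies can replace them. *)
Lemma signature_perm n l (y y' : 'I_l -> {ffun A -> nat}) x a :
  bijective_labels n y -> bijective_labels n y' ->
  signature y x a = signature y' x a.
Proof.
move=> By /(labels_perm By)[f fI yE].
rewrite /signature [RHS](reindex_inj fI); apply: eq_bigr => j _.
by rewrite yE.
Qed.

End Signature.

(** * Enumeration of the strategies *)

Section Enumeration.
Variable p : nat.
Implicit Type w : nat -> nat.

(** For [q < p] this is the sum of the entries up to index [q]. The conditional sum over all
    [v < p], like the truncated [1 - prefix_sum w u] below, mirrors an expression of the program. *)
Definition prefix_sum w q : nat := \sum_(v < p) (if v - q != 0 then 0 else w v).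

Definition leading_zeros w : nat := \sum_(u < p) (1 - prefix_sum w u).

(* The successor rule of Nijenhuis and Wilf's NEXCOM: with [t] the first index
   of a nonzero entry, move one unit from [t] to [t.+1] and the rest to [0]. *)
Definition next_comp w : nat -> nat := fun a =>
  let t := leading_zeros w in
  if a != 0 then
    if a - t != 0 then if a - (t + 1) != 0 then w a else w a + 1 else 0
  else prefix_sum w t - 1.

Definition first_comp n : nat -> nat := fun a => if a != 0 then 0 else n.

Definition composition n r : nat -> nat := iter r next_comp (first_comp n).

(* The number of compositions that follow [w] in the enumeration. *)
Definition remaining w : nat := \sum_(q < p.-1) 'C(prefix_sum w q + q, q.+1).

Lemma eq_prefix_sum w w' q :
  (forall a, a < p -> w a = w' a) -> prefix_sum w q = prefix_sum w' q.
Proof. by move=> E; apply: eq_bigr => v _; rewrite E. Qed.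

Lemma prefix_sumE w q : q < p -> prefix_sum w q = \sum_(v < q.+1) w v.
Proof.
move=> qp; rewrite (big_ord_widen _ _ qp) [RHS]big_mkcond.
by apply: eq_bigr => v _; rewrite ltnS subn_eq0; case: leqP.
Qed.

Lemma prefix_sum_mono w q q' : q <= q' -> prefix_sum w q <= prefix_sum w q'.
Proof.
move=> qq'; apply: leq_sum => v _; rewrite !subn_eq0.
by case: (leqP v q) => //= vq; rewrite (leq_trans vq qq').
Qed.

Lemma eq_leading_zeros w w' :
  (forall a, a < p -> w a = w' a) -> leading_zeros w = leading_zeros w'.
Proof. by move=> E; apply: eq_bigr => u _; rewrite (eq_prefix_sum _ E). Qed.

Lemma eq_next_comp w w' a :
  (forall a, a < p -> w a = w' a) -> a < p -> next_comp w a = next_comp w' a.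
Proof.
move=> E ap.
by rewrite /next_comp (eq_leading_zeros E) (eq_prefix_sum _ E) (E _ ap).
Qed.

(** Prefix sums are nondecreasing, so those equal to 0 form an initial segment, and counting them
    yields the index of the first nonzero entry. *)
Lemma leading_zerosP w q : q < p -> 0 < prefix_sum w q ->
  let t := leading_zeros w in
  [/\ t <= q, 0 < prefix_sum w t & forall u, u < t -> prefix_sum w u = 0].
Proof.
move=> qp q0; have ex : exists t, 0 < prefix_sum w t by exists q.
have [t t0 min_t] := ex_minnP ex; have tq := min_t q q0.
have z u : u < t -> prefix_sum w u = 0.
  by move=> ut; apply/eqP; rewrite -leqn0 leqNgt; apply/negP => /min_t; lia.
suff -> : leading_zeros w = t by [].
rewrite /leading_zeros (eq_bigr (fun u : 'I_p => (u < t : nat))) => [|u _].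
  rewrite -big_mkcond /= -(big_ord_widen _ (fun=> 1)) ?sum1_card ?card_ord //.
  exact: ltnW (leq_ltn_trans tq qp).
case: ltnP => [/z->//|tu].
by have := prefix_sum_mono w tu; lia.
Qed.

(** The step puts all but one unit of the entry at [t] at index 0 and the last unit at [t.+1], so
    prefix sums change only up to [t]. *)
Lemma prefix_sum_next w q : 0 < prefix_sum w (leading_zeros w) -> q < p ->
  prefix_sum (next_comp w) q =
  if q <= leading_zeros w then prefix_sum w (leading_zeros w) - 1
  else prefix_sum w q.
Proof.
move=> t0; elim: q => [|q IH] qp.
  by rewrite prefix_sumE // big_ord_recr big_ord0.
have qp' := ltnW qp.
rewrite prefix_sumE // big_ord_recr /= -prefix_sumE // IH //.
rewrite /next_comp /= !subn_eq0.
have S : prefix_sum w q.+1 = prefix_sum w q + w q.+1.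
  by rewrite !prefix_sumE // big_ord_recr.
set t := leading_zeros w in t0 *; case: (ltngtP q t) => [//|tq|Eq] /=.
  - by rewrite addn0.
  - by rewrite S ifT //; lia.
by rewrite S Eq ifF; lia.
Qed.

Lemma hockey_stick n m : (\sum_(q < m) 'C(n + q, q.+1)).+1 = 'C(n + m, m).
Proof.
elim: m => [|m IH]; first by rewrite big_ord0 bin0.
by rewrite big_ord_recr /= -addSn IH addnS binS addnC.
Qed.

(** Below [t] the binomials of [w] vanish. After the step, those up to [t] sum by the hockey-stick
    identity to one less than the former binomial at [t]; the others are unchanged. *)
Lemma remaining_next w : 0 < remaining w ->
  remaining w = (remaining (next_comp w)).+1 /\
  prefix_sum (next_comp w) p.-1 = prefix_sum w p.-1.
Proof.
move=> r0.
have [q q0] : exists q : 'I_p.-1, 0 < prefix_sum w q.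
  apply/existsP; move: r0; rewrite lt0n sum_nat_eq0; apply: contraR.
  rewrite negb_exists => /forallP z; apply/forallP => q; apply/implyP => _.
  by have := z q; rewrite -eqn0Ngt => /eqP ->; rewrite bin_small.
have qp : q < p.-1 := ltn_ord q.
have [tq t0 z] := leading_zerosP (leq_trans qp (leq_pred p)) q0.
have P := prefix_sum_next t0; set t := leading_zeros w in tq t0 z P.
split; last by rewrite P; [case: leqP => // ?|]; lia.
suff H m : t < m -> m <= p.-1 ->
    \sum_(q < m) 'C(prefix_sum w q + q, q.+1) =
    (\sum_(q < m) 'C(prefix_sum (next_comp w) q + q, q.+1)).+1.
  by apply: H => //; lia.
elim: m => [//|m IH]; rewrite ltnS leq_eqVlt => /orP[/eqP <-|tm] mp; last first.
  have mp' : m < p by lia.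
  rewrite big_ord_recr /= (IH tm (ltnW mp)) [in RHS]big_ord_recr /= (P m mp').
  by rewrite leqNgt tm.
rewrite big_ord_recr /= big1 => [|u _]; last by rewrite z // bin_small.
rewrite (eq_bigr (fun u : 'I_t.+1 => 'C(prefix_sum w t - 1 + u, u.+1))).
  by rewrite hockey_stick add0n; congr 'C(_, _); lia.
by move=> u _; rewrite P; [rewrite -ltnS ltn_ord | have := ltn_ord u; lia].
Qed.

(** [remaining] starts at [k.-1] and drops by one at each step, so it stays positive before the last
    composition and tells the compositions apart. *)
Lemma compositionP n r (k := 'C(n + p.-1, p.-1)) : 0 < p -> r < k ->
  prefix_sum (composition n r) p.-1 = n /\
  remaining (composition n r) = k.-1 - r.
Proof.
move=> p0; have first q : q < p -> prefix_sum (first_comp n) q = n.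
  by move=> qp; rewrite prefix_sumE // big_ord_recl /= big1 ?addn0.
elim: r => [|r IH] rk.
  rewrite first; last by lia.
  split=> //; rewrite subn0 /k -hockey_stick /=; apply: eq_bigr => q _.
  by rewrite first //; have := ltn_ord q; lia.
have [S R] := IH (ltnW rk).
have [|R' S'] := @remaining_next (composition n r); first by lia.
rewrite [composition n r.+1]iterS -/(composition n r) S' S; split=> //.
by move: R'; rewrite R; lia.
Qed.

End Enumeration.

(** * Bijective labelings from the enumeration *)

Section Labels.
Variable A : finType.

(** Stars and bars counts the strategies, so an injective labeling of the right size is onto. *)
Lemma card_labels_onto n m (x : 'I_m -> {ffun A -> nat}) :
  0 < #|A| -> m = 'C(n + #|A| - 1, #|A| - 1) ->
  (forall i, strategy n (x i)) -> injective x -> bijective_labels n x.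
Proof.
move=> A0 mE Sx xI; split=> // z Sz.
case EA: #|A| A0 mE => [//|p] _; rewrite addnS !subn1 /= => mE.
(* Strategies become tuples over ['I_n.+1]; a total of [n] bounds each entry, so [inord] loses
   nothing. *)
pose code (z : {ffun A -> nat}) : p.+1.-tuple 'I_n.+1 :=
  [tuple inord (z (enum_val (cast_ord (esym EA) i))) | i < p.+1].
have le_n z' a : strategy n z' -> z' a <= n.
  by rewrite /strategy (bigD1 a) //= => <-; rewrite leq_addr.
have codeI z1 z2 : strategy n z1 -> strategy n z2 -> code z1 = code z2 -> z1 = z2.
  move=> S1 S2 E; apply/ffunP => a.
  have := congr1 (fun t => val (tnth t (cast_ord EA (enum_rank a)))) E.
  by rewrite !tnth_mktuple cast_ordK enum_rankK /= !inordK ?ltnS ?le_n.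
pose X := [set t : p.+1.-tuple 'I_n.+1 | \sum_(i <- t) i == n].
have codeX z' : strategy n z' -> code z' \in X.
  move=> S; rewrite inE; apply/eqP; rewrite big_tuple -[RHS]S.
  rewrite (reindex (fun i : 'I_p.+1 => enum_val (cast_ord (esym EA) i))) /=.
    by apply: eq_bigr => i _; rewrite tnth_mktuple inordK ?ltnS ?le_n.
  exists (fun a => cast_ord EA (enum_rank a)) => [i _|a _].
    by rewrite enum_valK cast_ordKV.
  by rewrite cast_ordK enum_rankK.
have : [set code (x i) | i : 'I_m] == X.
  rewrite eqEcard; apply/andP; split.
    by apply/subsetP => _ /imsetP[i _ ->]; apply: codeX.
  rewrite card_imset ?card_ord ?mE ?card_ord_partitions 1?addnC //.
  by move=> i j /codeI E; apply: xI; apply: E.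
move=> /eqP XE; have := codeX z Sz; rewrite -XE => /imsetP[i _ E].
by exists i; apply: codeI.
Qed.

Definition composition_label n (i : nat) : {ffun A -> nat} :=
  [ffun a => composition #|A| n i (enum_rank a)].

Lemma composition_labels n m :
  0 < #|A| -> m = 'C(n + #|A| - 1, #|A| - 1) ->
  bijective_labels n (fun i : 'I_m => composition_label n i).
Proof.
move=> A0 mE; have mE' : m = 'C(n + #|A|.-1, #|A|.-1).
  by rewrite mE; congr 'C(_, _); lia.
have CP (i : 'I_m) := @compositionP #|A| n i A0.
apply: card_labels_onto => // [i|i j E].
  have [|S _] := CP i; first by rewrite -mE'.
  rewrite /strategy -[RHS]S prefix_sumE ?prednK //.
  rewrite (reindex _ (onW_bij _ (enum_val_bij A))) /=.
  by apply: eq_bigr => a _; rewrite ffunE enum_valK.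
apply: val_inj => /=.
have [|_ Ri] := CP i; first by rewrite -mE'.
have [|_ Rj] := CP j; first by rewrite -mE'.
have : remaining #|A| (composition #|A| n i) = remaining #|A| (composition #|A| n j).
  apply: eq_bigr => q _; congr 'C(_ + _, _); apply: eq_prefix_sum => a ap.
  have /ffunP/(_ (enum_val (Ordinal ap))) := E.
  by rewrite !ffunE enum_valK.
by rewrite Ri Rj -mE'; have := ltn_ord i; have := ltn_ord j; lia.
Qed.

End Labels.

(** * Matching by keys and ranks *)

Section Matching.
Variables (n : nat) (T : eqType).
Implicit Types u v : 'I_n -> T.

Definition class_rank u (i : 'I_n) : nat :=
  \sum_(j < n) ((j < i) && (u j == u i)).

(** Keys may repeat; comparing also the ranks within a class of equal keys makes partners unique on
    both sides. *)
Definition good_match u v i r : bool :=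
  (u i == v r) && (class_rank u i == class_rank v r).

Lemma class_rankE u i : class_rank u i = #|[set j : 'I_n | (j < i) && (u j == u i)]|.
Proof. rewrite cardsE -sum1_card [RHS]big_mkcond; apply: eq_bigr => j _.
by rewrite unfold_in; case: (_ && _). Qed.

Lemma class_rank_inj v r r' :
  v r = v r' -> class_rank v r = class_rank v r' -> r = r'.
Proof.
wlog le_rr : r r' / r <= r'.
  move=> H; case/orP: (leq_total r r') => le; first exact: H.
  by move=> E1 E2; apply/esym/H.
move=> Ev Er; apply/val_inj/eqP; rewrite /= eqn_leq le_rr leqNgt; apply/negP => lt.
have : class_rank v r < class_rank v r'.
  rewrite !class_rankE; apply: proper_card; apply/properP; split.
    apply/subsetP => j; rewrite !inE Ev => /andP[jr ->].
    by rewrite (ltn_trans jr lt).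
  by exists r; rewrite !inE ?lt ?Ev ?eqxx ?ltnn.
by rewrite Er ltnn.
Qed.

Lemma good_match_fun u v i r r' : good_match u v i r -> good_match u v i r' -> r = r'.
Proof.
move=> /andP[/eqP E1 /eqP R1] /andP[/eqP E2 /eqP R2].
by apply: (@class_rank_inj v); rewrite -?E1 -?R1.
Qed.

Lemma good_match_inj u v i i' r : good_match u v i r -> good_match u v i' r -> i = i'.
Proof.
move=> /andP[/eqP E1 /eqP R1] /andP[/eqP E2 /eqP R2].
by apply: (@class_rank_inj u); rewrite ?E1 ?R1.
Qed.

(** The classes of a key in [u] and in [v] have equal size, and the ranks in a class of size c are
    exactly the numbers below c. *)
Lemma good_match_exists u v (f : 'I_n -> 'I_n) :
  injective f -> (forall i, u i = v (f i)) ->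
  forall i, exists r, good_match u v i r.
Proof.
move=> fI Ef i.
pose C := [set j | u j == u i]; pose B := [set r | v r == u i].
have BC : #|B| = #|C|.
  rewrite -(card_imset C fI); apply: eq_card => r; rewrite inE.
  have [g fg gf] := injF_bij fI; rewrite -{1}(gf r) -Ef.
  apply/idP/imsetP => [E|[j + ->]]; last by rewrite fg inE.
  by exists (g r); rewrite ?gf // inE.
have rank_lt w r (D := [set j | w j == w r]) : class_rank w r < #|D|.
  rewrite class_rankE; apply: proper_card; apply/properP; split.
    by apply/subsetP => j; rewrite !inE => /andP[].
  by exists r; rewrite !inE ?ltnn ?eqxx.
have rank_n w r : class_rank w r < n.
  apply: leq_trans (rank_lt w r) _; rewrite -[X in _ <= X]card_ord; exact: max_card.
pose rk r := Ordinal (rank_n v r).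
have : rk @: B == [set k : 'I_n | k < #|B|].
  rewrite eqEcard; apply/andP; split.
    apply/subsetP => _ /imsetP[r + ->]; rewrite !inE => /eqP E.
    by have := rank_lt v r; rewrite E.
  rewrite card_in_imset => [|r r']; last first.
    rewrite !inE => /eqP E /eqP E' /(congr1 val) /= R.
    by apply: class_rank_inj R; rewrite E E'.
  have Bn : #|B| <= n by rewrite -[X in _ <= X]card_ord; exact: max_card.
  by rewrite -sum1dep_card -(big_ord_widen n (fun=> 1) Bn) sum1_card card_ord.
move=> /eqP BE.
have : Ordinal (rank_n u i) \in [set k : 'I_n | k < #|B|].
  by rewrite inE /= BC rank_lt.
rewrite -BE => /imsetP[r rB /(congr1 val) /= R]; exists r.
by move: rB; rewrite inE /good_match R eqxx andbT eq_sym.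
Qed.

(** Uniqueness of the partner leaves at most one nonzero term, so a sum can extract it. *)
Lemma sum_good_match u v i r :
  good_match u v i r -> \sum_(r' < n) (if good_match u v i r' then r' : nat else 0) = r.
Proof.
move=> g; rewrite (bigD1 r) //= g big1 ?addn0 // => r' neq.
case: ifP => // g'.
by rewrite (good_match_fun g' g) eqxx in neq.
Qed.

End Matching.

(** * Enumeration and matching as programs *)

(* Unfolds [xeval] without unfolding the macros in its argument. *)
Ltac xsimp := cbn [xeval]; fold xeval.

Definition xnot (e : xexp) : xexp := XSub (XNum 1) e.

Definition xdist (e f : xexp) : xexp := XAdd (XSub e f) (XSub f e).

Definition xcell (b : nat) (e : xexp) (a : nat) : xexp :=
  XGet b (XAdd (xmul e 2) (XVar a)).

Lemma xdist_eq0 s rho e f :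
  (xeval s rho (xdist e f) == 0) = (xeval s rho e == xeval s rho f).
Proof. by rewrite /=; lia. Qed.

(** Since [xmul] binds variable 0, the index must not depend on it. *)
Lemma xcellE s rho b e a : a != 0 -> 
  (forall n, xeval s (upd rho 0 n) e = xeval s rho e) ->
  xeval s rho (xcell b e a) = s b (xeval s rho e * s 0 2 + rho a).
Proof.
move=> a0 E; rewrite /xcell /=; congr (s b (_ + _)).
by rewrite (eq_bigr _ (fun (i : 'I__) _ => E i)) sum_nat_const card_ord mulnC.
Qed.

Arguments xcell : simpl never.

Lemma xcell_varE s rho b v a : v != 0 -> a != 0 ->
  xeval s rho (xcell b (XVar v) a) = s b (rho v * s 0 2 + rho a).
Proof. by move=> v0 a0; rewrite xcellE //= => n; rewrite /upd (negbTE v0). Qed.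

Section EnumerationProgram.
Variables b c : nat.

(* Variable 1 is the row, variable 2 the column. *)
Definition xprev (a : nat) : xexp := xcell b (XSub (XVar 1) (XNum 1)) a.
Arguments xprev : simpl never.

(** The bound variable is a parameter so that the count of leading zeros, which uses 3 and 4, can be
    nested in a prefix sum over variable 5. *)
Definition xprefix_sum (q : xexp) (v : nat) : xexp :=
  XSum v 2 (XIf (XSub (XVar v) q) (XNum 0) (xprev v)).

Definition xleading_zeros : xexp := XSum 3 2 (xnot (xprefix_sum (XVar 3) 4)).

Definition xnext_comp : xexp :=
  XIf (XVar 2)
    (XIf (XSub (XVar 2) xleading_zeros)
       (XIf (XSub (XVar 2) (XAdd xleading_zeros (XNum 1)))
          (xprev 2) (XAdd (xprev 2) (XNum 1)))
       (XNum 0))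
    (XSub (xprefix_sum xleading_zeros 5) (XNum 1)).

Definition xcomposition : xexp :=
  XIf (XVar 1) xnext_comp (XIf (XVar 2) (XNum 0) (XGet 0 (XNum c))).

Lemma xprevE s rho a : a != 0 ->
  xeval s rho (xprev a) = s b ((rho 1 - 1) * s 0 2 + rho a).
Proof. by move=> a0; rewrite /xprev xcellE. Qed.

Lemma xleading_zerosE s rho :
  xeval s rho xleading_zeros =
  leading_zeros (s 0 2) (fun v => s b ((rho 1 - 1) * s 0 2 + v)).
Proof.
apply: eq_bigr => u _; congr (_ - _); apply: eq_bigr => v _.
by xsimp; rewrite xprevE.
Qed.

Lemma xnext_compE s rho :
  xeval s rho xnext_comp =
  next_comp (s 0 2) (fun v => s b ((rho 1 - 1) * s 0 2 + v)) (rho 2).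
Proof.
rewrite /xnext_comp /next_comp; xsimp.
rewrite xleading_zerosE xprevE //; congr (if _ then _ else _ - _).
by apply: eq_bigr => v _; xsimp; rewrite xleading_zerosE xprevE.
Qed.

(** Row [i] is computed from row [i - 1], complete by then because the table is filled row by
    row. *)
Lemma xcompositionP rho s r (n := s 0 c) (p := s 0 2) : b != 0 ->
  forall i a, i < s 0 r -> a < p ->
  sden (stable b 1 r 2 xcomposition) rho s b (i * p + a) = composition p n i a.
Proof.
move=> b0; apply: stableP => // i a s' ilt alt fr prev.
have f0 x : s' 0 x = s 0 x by apply: fr; rewrite eq_sym.
rewrite /xcomposition; xsimp; rewrite xnext_compE /upd /= !f0.
case: i ilt prev => [|i] ilt prev //=.
rewrite subn1 /=; apply: eq_next_comp => // a' lta'.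
by apply: prev => //; left.
Qed.

End EnumerationProgram.

Section MatchingProgram.
Variables (r : nat) (UU VV UV : xexp).

(* Variables 1 and 2 are the indices to be matched, [UV] tests whether their
   keys differ, [UU] and [VV] compare keys of the same side, the smaller index
   being variable 3. *)
Definition xrank (i : nat) (ne : xexp) : xexp :=
  XSum 3 r (XIf (XSub (XVar i) (XVar 3)) (xnot ne) (XNum 0)).

Definition xmismatch : xexp := XAdd UV (xdist (xrank 1 UU) (xrank 2 VV)).

Definition xselect : xexp := XSum 2 r (XIf xmismatch (XNum 0) (XVar 2)).

(** Each index contributes 1 exactly when its number of partners is 0. *)
Definition xunmatched : xexp := XSum 1 r (xnot (XSum 2 r (xnot xmismatch))).

Variables (n : nat) (T : eqType) (u v : 'I_n -> T) (s : state).
Hypothesis sn : s 0 r = n.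
Hypothesis UUP : forall (rho : nat -> nat) (j i : 'I_n), rho 3 = j -> rho 1 = i ->
  (xeval s rho UU == 0) = (u j == u i).
Hypothesis VVP : forall (rho : nat -> nat) (j i : 'I_n), rho 3 = j -> rho 2 = i ->
  (xeval s rho VV == 0) = (v j == v i).
Hypothesis UVP : forall (rho : nat -> nat) (i m : 'I_n), rho 1 = i -> rho 2 = m ->
  (xeval s rho UV == 0) = (u i == v m).

Lemma xmismatchP (rho : nat -> nat) (i m : 'I_n) : rho 1 = i -> rho 2 = m ->
  (xeval s rho xmismatch == 0) = good_match u v i m.
Proof.
move=> r1 r2; rewrite /xmismatch; xsimp.
rewrite addn_eq0 xdist_eq0 (UVP r1 r2) /good_match; congr (_ && (_ == _)).
  rewrite /xrank; xsimp; rewrite sn; apply: eq_bigr => j _.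
  rewrite /upd /= r1 -/(upd rho 3 j) subn_eq0 leqNgt negbK.
  have := @UUP (upd rho 3 j) j i erefl r1; case: ltnP => //= _ <-.
  by case: xeval.
rewrite /xrank; xsimp; rewrite sn; apply: eq_bigr => j _.
rewrite /upd /= r2 -/(upd rho 3 j) subn_eq0 leqNgt negbK.
have := @VVP (upd rho 3 j) j m erefl r2; case: ltnP => //= _ <-.
by case: xeval.
Qed.

Lemma xselectP (rho : nat -> nat) (i m : 'I_n) : rho 1 = i -> good_match u v i m ->
  xeval s rho xselect = m.
Proof.
move=> r1 gm; rewrite -(sum_good_match gm) /xselect; xsimp; rewrite sn.
apply: eq_bigr => m' _.
by rewrite (@xmismatchP (upd rho 2 m') i m') //; case: good_match.
Qed.

Lemma xunmatchedP rho : xeval s rho xunmatched = 0 <->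
  forall i, exists m, good_match u v i m.
Proof.
rewrite /xunmatched; xsimp; rewrite sn.
have mE (i m : 'I_n) := @xmismatchP (upd (upd rho 1 i) 2 m) i m erefl erefl.
split=> [/eqP|ex].
  rewrite sum_nat_eq0 => /forallP z i; have := z i.
  rewrite implyTb /xnot; xsimp.
  rewrite sn subn_eq0 lt0n sum_nat_eq0 negb_forall => /existsP[m].
  by rewrite implyTb subn_eq0 -ltnNge ltnS leqn0 mE => g; exists m.
rewrite big1 // => i _; apply/eqP; rewrite /xnot; xsimp; rewrite sn subn_eq0.
have [m gm] := ex i.
by rewrite (bigD1 m) //; move: gm; rewrite -mE => /eqP ->.
Qed.

End MatchingProgram.

(** * The recognition algorithm *)

(** A candidate wins exactly when no truncated difference [z c - z a] is positive. *)
Definition xAM (b1 v1 b2 v2 a : nat) : xexp :=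
  let z c := XAdd (xcell b1 (XVar v1) c) (xcell b2 (XVar v2) c) in
  xnot (XSum 7 2 (XSub (z 7) (z a))).

(** For [a] in the set, being its only element means that at most one bit is set. *)
Definition xweight (bits : nat -> xexp) (a : nat) : xexp :=
  XIf (bits a)
    (XIf (XSub (XSum 6 2 (bits 6)) (XNum 1)) (XNum 1) (XNum 2))
    (XNum 0).

(** * Keys of rows and columns *)

Section Keys.
Variables (A : finType) (alpha beta K L : nat) (h : 'M[{set A}]_(K, L)).
Variables (gx : 'I_K -> {ffun A -> nat}) (gy : 'I_L -> {ffun A -> nat}).

Definition row_keys (i : 'I_K) : {ffun A -> nat} :=
  [ffun a => \sum_j weight (h i j) a].

Definition label_keys (r : 'I_K) : {ffun A -> nat} :=
  [ffun a => signature gy (gx r) a].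

Definition column_keys (j : 'I_L) : {ffun 'I_K -> {set A}} := [ffun i => h i j].

Definition AM_keys (m : 'I_L) : {ffun 'I_K -> {set A}} :=
  [ffun i => AM (fun c => gx i c + gy m c)].

(** Whichever labeling realises [h], the weights along a row add up to the signature of its label,
    even when computed with the reference labels [gy]. *)
Lemma row_keysE x y : DAV_labeling alpha beta h x y ->
  bijective_labels beta gy ->
  forall i a, row_keys i a = signature gy (x i) a.
Proof.
move=> [_ By hE] Bgy i a; rewrite ffunE -(signature_perm _ _ By Bgy).
by apply: eq_bigr => j _; rewrite hE.
Qed.

Lemma row_match_exists : is_DAV alpha beta h ->
  bijective_labels alpha gx -> bijective_labels beta gy ->
  forall i, exists r, good_match row_keys label_keys i r.
Proof.
move=> [x [y D]] Bx By; have [Bx' _ _] := D.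
have [f fI xE] := labels_perm Bx' Bx.
apply: (good_match_exists fI) => i; apply/ffunP => a.
by rewrite (row_keysE D By) ffunE xE.
Qed.

Lemma row_match_label x y i r : alpha <= beta \/ #|A| <= 1 ->
  DAV_labeling alpha beta h x y ->
  bijective_labels alpha gx -> bijective_labels beta gy ->
  good_match row_keys label_keys i r -> gx r = x i.
Proof.
move=> le_ab D [Sgx _ _] Bgy /andP[/eqP E _]; have [[Sx _ _] _ _] := D.
apply: (signature_inj le_ab Bgy) => // a.
by rewrite -(row_keysE D Bgy) E ffunE.
Qed.

Lemma column_match_exists x y : DAV_labeling alpha beta h x y ->
  gx =1 x -> bijective_labels beta gy ->
  forall j, exists m, good_match column_keys AM_keys j m.
Proof.
move=> [_ By hE] Ex Bgy; have [f fI yE] := labels_perm By Bgy.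
apply: (good_match_exists fI) => j; apply/ffunP => i.
by rewrite !ffunE hE Ex yE.
Qed.

End Keys.

Section MatchLabels.
Variable A : finType.

(** Equal labels come from the same partner, which belongs to one index only; so [z'] is injective,
    and counting makes it onto. *)
Lemma match_labels n m (z z' : 'I_m -> {ffun A -> nat}) (T : eqType)
    (u v : 'I_m -> T) :
  0 < #|A| -> m = 'C(n + #|A| - 1, #|A| - 1) -> bijective_labels n z ->
  (forall i, exists2 r, good_match u v i r & z' i = z r) ->
  bijective_labels n z'.
Proof.
move=> A0 mE [Sz zI _] ex; apply: card_labels_onto => // [i|i i' E].
  by have [r _ ->] := ex i.
have [r g Er] := ex i; have [r' g' Er'] := ex i'.
have rr' : r = r' by apply: zI; rewrite -Er -Er' E.
by apply: good_match_inj g _; rewrite rr'.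
Qed.

(** Soundness of a positive answer: equal column keys say that [h i j] is the winner set of
    [x i + y j], and the matchings make [x] and [y] bijective. *)
Lemma match_DAV_labeling alpha beta K L (h : 'M[{set A}]_(K, L))
    gx gy (x : 'I_K -> {ffun A -> nat}) (y : 'I_L -> {ffun A -> nat}) :
  0 < #|A| -> K = 'C(alpha + #|A| - 1, #|A| - 1) ->
  L = 'C(beta + #|A| - 1, #|A| - 1) ->
  bijective_labels alpha gx -> bijective_labels beta gy ->
  (forall i, exists2 r,
     good_match (row_keys h) (label_keys gx gy) i r & x i = gx r) ->
  (forall j, exists2 m,
     good_match (column_keys h) (AM_keys x gy) j m & y j = gy m) ->
  DAV_labeling alpha beta h x y.
Proof.
move=> A0 KE LE Bx By rows cols; split; [exact: match_labels rows|
  exact: match_labels cols|move=> i j].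
have [m /andP[/eqP/ffunP/(_ i) + _] ->] := cols j.
by rewrite !ffunE.
Qed.

Lemma eq_bijective_labels n m (x x' : 'I_m -> {ffun A -> nat}) :
  x =1 x' -> bijective_labels n x -> bijective_labels n x'.
Proof.
move=> E [Sx xI xE]; split=> [i|i j|z Sz]; rewrite -?E //.
  by rewrite -?E; apply: xI.
by have [i <-] := xE z Sz; exists i.
Qed.

Lemma eq_DAV_labeling alpha beta K L (h : 'M[{set A}]_(K, L)) x x' y y' :
  x =1 x' -> y =1 y' ->
  DAV_labeling alpha beta h x y -> DAV_labeling alpha beta h x' y'.
Proof.
move=> Ex Ey [Bx By hE]; split=> [||i j].
- exact: eq_bijective_labels Bx.
- exact: eq_bijective_labels By.
- by rewrite hE -Ex -Ey.
Qed.

End MatchLabels.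

(** The selector is evaluated anew for each cell while array [b] is being filled, so its value has
    to survive changes of [b] and be determined by variable 1. *)
Lemma select_tableP b b' r sel s rho n p :
  s 0 r = n -> s 0 2 = p ->
  b != 0 -> b' != b ->
  (forall i, i < n -> exists m, forall s' rho',
     (forall b1 n, b1 != b -> s' b1 n = s b1 n) -> rho' 1 = i ->
     xeval s' rho' sel = m) ->
  forall i a m, i < n -> a < p ->
    (forall rho', rho' 1 = i -> xeval s rho' sel = m) ->
    sden (stable b 1 r 4 (xcell b' sel 4)) rho s b (i * p + a) =
    s b' (m * p + a).
Proof.
move=> <- <- b0 bb' sel_const i a m ilt alt Em.
pose F i a := xeval s (upd (upd rho 1 i) 4 a) (xcell b' sel 4).
have FE : F i a = s b' (m * s 0 2 + a).
  by rewrite /F xcellE // => [|k]; rewrite !Em.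
rewrite -FE; apply: stableP => // {m Em FE}i {}a s' {}ilt {}alt fr _.
have [m Em] := sel_const i ilt.
rewrite /F !xcellE // => [|k|k]; rewrite !Em //.
by rewrite fr // [s' 0 2]fr // eq_sym.
Qed.

(** * Labels for one orientation of the matrix *)

Section CoreProgram.
(* Cells of array 0 holding the numbers of rows and columns and of the voting
   cards, arrays for the labels, and the bit [a \in h i j] as an expression in
   the variables holding [i], [j] and [a]. *)
Variables (rK rL ca cb oX oY : nat) (bit : nat -> nat -> nat -> xexp).

Definition row_key (i : nat) : xexp := XSum 5 rL (xweight (bit i 5) 4).

Definition label_key (r : nat) : xexp := XSum 5 rL (xweight (xAM 5 r 6 5) 4).

Definition rows_differ (e f : xexp) : xexp := XSum 4 2 (xdist e f).

Definition columns_differ (e f : xexp) : xexp :=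
  XSum 5 rK (XSum 4 2 (xdist e f)).

Definition row_match (M : nat -> xexp -> xexp -> xexp -> xexp) : xexp :=
  M rK (rows_differ (row_key 3) (row_key 1))
       (rows_differ (label_key 3) (label_key 2))
       (rows_differ (row_key 1) (label_key 2)).

Definition column_match (M : nat -> xexp -> xexp -> xexp -> xexp) : xexp :=
  M rL (columns_differ (bit 5 3 4) (bit 5 1 4))
       (columns_differ (xAM oX 5 6 3 4) (xAM oX 5 6 2 4))
       (columns_differ (bit 5 1 4) (xAM oX 5 6 2 4)).

(** The column step reads the row labels just stored in [oX]. The parameters let the same program
    treat the transposed matrix. *)
Definition core : stmt :=
  SSeq (stable 5 1 rK 2 (xcomposition 5 ca))
  (SSeq (stable 6 1 rL 2 (xcomposition 6 cb))
  (SSeq (stable oX 1 rK 4 (xcell 5 (row_match xselect) 4))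
  (SSeq (stable oY 1 rL 4 (xcell 6 (column_match xselect) 4))
     (SStore 2 (XNum 0)
        (xnot (XAdd (row_match xunmatched) (column_match xunmatched))))))).

Variables (A : finType) (alpha beta K L : nat) (h : 'M[{set A}]_(K, L)).
Variable s0 : state.

Definition same_input (s : state) : Prop := forall b n, b < 2 -> s b n = s0 b n.

Definition stores (s : state) (b m : nat) (g : 'I_m -> {ffun A -> nat}) : Prop :=
  forall (i : 'I_m) a, s b (i * #|A| + enum_rank a) = g i a.

Hypothesis oXY : [&& oX != oY, 2 < oX, oX < 5, 2 < oY & oY < 5].
Hypothesis s0K : s0 0 rK = K.
Hypothesis s0L : s0 0 rL = L.
Hypothesis s0p : s0 0 2 = #|A|.
Hypothesis s0a : s0 0 ca = alpha.
Hypothesis s0b : s0 0 cb = beta.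
Hypothesis bitP : forall s (rho : nat -> nat) vi vj va (i : 'I_K) (j : 'I_L) (a : A),
  same_input s -> 0 < vi -> 0 < vj -> 0 < va ->
  rho vi = i -> rho vj = j -> rho va = enum_rank a ->
  xeval s rho (bit vi vj va) = (a \in h i j).
Hypothesis A0 : 0 < #|A|.
Hypothesis KE : K = 'C(alpha + #|A| - 1, #|A| - 1).
Hypothesis LE : L = 'C(beta + #|A| - 1, #|A| - 1).
Hypothesis le_ab : alpha <= beta \/ #|A| <= 1.

Lemma sum_enum (F : 'I_#|A| -> nat) (G : A -> nat) :
  (forall a, F (enum_rank a) = G a) -> \sum_(i < #|A|) F i = \sum_a G a.
Proof.
move=> E; rewrite (reindex _ (onW_bij _ (enum_rank_bij A))) /=.
by apply: eq_big => a; rewrite ?inE ?E.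
Qed.

Lemma xAMP s (rho : nat -> nat) b1 v1 b2 v2 va m1 m2 (g1 : 'I_m1 -> {ffun A -> nat})
    (g2 : 'I_m2 -> {ffun A -> nat}) (i : 'I_m1) (j : 'I_m2) (a : A) :
  same_input s -> stores s b1 g1 -> stores s b2 g2 ->
  v1 != 0 -> v1 != 7 -> v2 != 0 -> v2 != 7 -> va != 0 -> va != 7 ->
  rho v1 = i -> rho v2 = j -> rho va = enum_rank a ->
  xeval s rho (xAM b1 v1 b2 v2 va) = (a \in AM (fun c => g1 i c + g2 j c)).
Proof.
move=> si st1 st2 v10 v17 v20 v27 va0 va7 r1 r2 ra.
rewrite /xAM /xnot; xsimp; rewrite (@si 0) // s0p.
rewrite (sum_enum (G := fun c => g1 i c + g2 j c - (g1 i a + g2 j a))); last first.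
  move=> c; rewrite !xcell_varE //.
  rewrite /upd (negbTE v17) (negbTE v27) (negbTE va7) /= r1 r2 ra.
  by rewrite (@si 0) // s0p !st1 !st2.
case: AMP => [le|nle].
  by rewrite big1 // => c _; apply/eqP; rewrite subn_eq0.
apply/eqP; rewrite subn_eq0 lt0n sum_nat_eq0; apply/negP => /forallP z.
by apply: nle => c; have := z c; rewrite implyTb subn_eq0.
Qed.

Lemma xweightP s (rho : nat -> nat) (bits : nat -> xexp) (B : {set A}) (a : A) :
  same_input s ->
  rho 4 = enum_rank a -> xeval s rho (bits 4) = (a \in B) ->
  (forall c, xeval s (upd rho 6 (enum_rank c)) (bits 6) = (c \in B)) ->
  xeval s rho (xweight bits 4) = weight B a.
Proof.
move=> si ra E4 E6; rewrite /xweight; xsimp; rewrite E4 (@si 0) // s0p.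
rewrite (sum_enum E6) -big_mkcond sum1_card /weight.
case: (boolP (a \in B)) => aB /=; last first.
  by case: eqP aB => // ->; rewrite set11.
have B0 : 0 < #|B| by apply/card_gt0P; exists a.
have -> : (B == [set a]) = (#|B| <= 1).
  by rewrite eq_sym eqEcard sub1set aB cards1.
by rewrite subn_eq0; case: leqP.
Qed.

Section Rows.
Variables (s : state) (gx : 'I_K -> {ffun A -> nat}) (gy : 'I_L -> {ffun A -> nat}).
Hypothesis si : same_input s.
Hypothesis sx : stores s 5 gx.
Hypothesis sy : stores s 6 gy.

Lemma row_keyP (rho : nat -> nat) (v : nat) (i : 'I_K) (a : A) : v \in [:: 1; 3] ->
  rho v = i -> rho 4 = enum_rank a -> xeval s rho (row_key v) = row_keys h i a.
Proof.
move=> v13 rv ra; rewrite /row_key; xsimp; rewrite (@si 0) // s0L ffunE.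
apply: eq_bigr => j _; apply: xweightP => // [|c]; apply: bitP => //.
all: by move: rv v13; rewrite !inE => ? /orP[] /eqP E; subst v.
Qed.

Lemma label_keyP (rho : nat -> nat) (v : nat) (r : 'I_K) (a : A) : v \in [:: 2; 3] ->
  rho v = r -> rho 4 = enum_rank a -> xeval s rho (label_key v) = label_keys gx gy r a.
Proof.
move=> v23 rv ra; rewrite /label_key; xsimp; rewrite (@si 0) // s0L ffunE.
apply: eq_bigr => j _; apply: xweightP => // [|c].
all: apply: (xAMP (g1 := gx) (g2 := gy)) => //.
all: by move: rv v23; rewrite !inE => ? /orP[] /eqP E; subst v.
Qed.

Lemma rows_differP (rho : nat -> nat) e f (u v : {ffun A -> nat}) :
  (forall a, xeval s (upd rho 4 (enum_rank a)) e = u a) ->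
  (forall a, xeval s (upd rho 4 (enum_rank a)) f = v a) ->
  (xeval s rho (rows_differ e f) == 0) = (u == v).
Proof.
move=> Ee Ef; rewrite /rows_differ; xsimp; rewrite (@si 0) // s0p.
rewrite sum_nat_eq0; apply/forallP/eqP => [z|uv i].
  apply/ffunP => a; apply/eqP; have := z (enum_rank a).
  by rewrite implyTb xdist_eq0 Ee Ef.
by rewrite implyTb xdist_eq0 -(enum_valK i) Ee Ef uv.
Qed.

Lemma row_selectP (rho : nat -> nat) (i r : 'I_K) :
  rho 1 = i -> good_match (row_keys h) (label_keys gx gy) i r ->
  xeval s rho (row_match xselect) = r.
Proof.
apply: xselectP; first by rewrite si.
- by move=> rho' j i' r3 r1; apply: rows_differP => a; apply: row_keyP.
- by move=> rho' j i' r3 r1; apply: rows_differP => a; apply: label_keyP.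
- by move=> rho' i' m r1 r2; apply: rows_differP => a;
    [apply: row_keyP | apply: label_keyP].
Qed.

Lemma row_unmatchedP (rho : nat -> nat) :
  xeval s rho (row_match xunmatched) = 0 <->
  forall i, exists r, good_match (row_keys h) (label_keys gx gy) i r.
Proof.
apply: xunmatchedP; first by rewrite si.
- by move=> rho' j i' r3 r1; apply: rows_differP => a; apply: row_keyP.
- by move=> rho' j i' r3 r1; apply: rows_differP => a; apply: label_keyP.
- by move=> rho' i' m r1 r2; apply: rows_differP => a;
    [apply: row_keyP | apply: label_keyP].
Qed.

End Rows.

Section Columns.
Variables (s : state) (gx : 'I_K -> {ffun A -> nat}) (gy : 'I_L -> {ffun A -> nat}).
Hypothesis si : same_input s.
Hypothesis sx : stores s oX gx.
Hypothesis sy : stores s 6 gy.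

Lemma columns_differP (rho : nat -> nat) e f (u v : {ffun 'I_K -> {set A}}) :
  (forall (i : 'I_K) a,
     xeval s (upd (upd rho 5 i) 4 (enum_rank a)) e = (a \in u i)) ->
  (forall (i : 'I_K) a,
     xeval s (upd (upd rho 5 i) 4 (enum_rank a)) f = (a \in v i)) ->
  (xeval s rho (columns_differ e f) == 0) = (u == v).
Proof.
move=> Ee Ef; rewrite /columns_differ; xsimp; rewrite (@si 0) // s0K.
rewrite sum_nat_eq0; apply/forallP/eqP => [z|uv i].
  apply/ffunP => i; apply/setP => a; have := z i.
  rewrite implyTb (@si 0) // s0p sum_nat_eq0 => /forallP /(_ (enum_rank a)).
  by rewrite implyTb xdist_eq0 Ee Ef; do 2 case: (a \in _).
rewrite implyTb (@si 0) // s0p sum_nat_eq0; apply/forallP => j.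
by rewrite implyTb xdist_eq0 -(enum_valK j) Ee Ef uv.
Qed.

Lemma column_selectP (rho : nat -> nat) (j m : 'I_L) :
  rho 1 = j -> good_match (column_keys h) (AM_keys gx gy) j m ->
  xeval s rho (column_match xselect) = m.
Proof.
apply: xselectP; first by rewrite si.
- by move=> rho' j' j1 r3 r1; apply: columns_differP => i a;
    rewrite ffunE; apply: bitP.
- by move=> rho' j' j1 r3 r1; apply: columns_differP => i a;
    rewrite ffunE; apply: (xAMP (g1 := gx) (g2 := gy)).
- by move=> rho' j' m' r1 r2; apply: columns_differP => i a; rewrite ffunE;
    [apply: bitP | apply: (xAMP (g1 := gx) (g2 := gy))].
Qed.

Lemma column_unmatchedP (rho : nat -> nat) :
  xeval s rho (column_match xunmatched) = 0 <->
  forall j, exists m, good_match (column_keys h) (AM_keys gx gy) j m.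
Proof.
apply: xunmatchedP; first by rewrite si.
- by move=> rho' j' j1 r3 r1; apply: columns_differP => i a;
    rewrite ffunE; apply: bitP.
- by move=> rho' j' j1 r3 r1; apply: columns_differP => i a;
    rewrite ffunE; apply: (xAMP (g1 := gx) (g2 := gy)).
- by move=> rho' j' m' r1 r2; apply: columns_differP => i a; rewrite ffunE;
    [apply: bitP | apply: (xAMP (g1 := gx) (g2 := gy))].
Qed.

End Columns.

(** If [h] is a DAV correspondence, signatures force the row labels found to be the true ones, and
    then every column finds a partner. Conversely, complete matchings give a labeling. *)
Lemma coreP rho (s1 := sden core rho s0) :
  (exists b : bool, output_bit s1 = b /\ (b <-> is_DAV alpha beta h)) /\
  (is_DAV alpha beta h -> DAV_labeling alpha beta h
     (@output_labels A s1 oX K) (@output_labels A s1 oY L)).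
Proof.
have /and5P[oXY' X2 X5 Y2 Y5] := oXY.
pose gx (i : 'I_K) : {ffun A -> nat} := composition_label A alpha i.
pose gy (j : 'I_L) : {ffun A -> nat} := composition_label A beta j.
have Bx : bijective_labels alpha gx by apply: composition_labels.
have By : bijective_labels beta gy by apply: composition_labels.
rewrite {}/s1 /core; cbn [sden]; fold sden.
set sA := sden (stable 5 _ _ _ _) rho s0.
set sB := sden (stable 6 _ _ _ _) rho sA.
set sC := sden (stable oX _ _ _ _) rho sB.
set sD := sden (stable oY _ _ _ _) rho sC.
have frA b n : b != 5 -> sA b n = s0 b n by apply: stable_frame.
have frB b n : b != 6 -> sB b n = sA b n by apply: stable_frame.
have frC b n : b != oX -> sC b n = sB b n by apply: stable_frame.
have frD b n : b != oY -> sD b n = sC b n by apply: stable_frame.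
have siA : same_input sA by move=> b n b2; rewrite frA //; lia.
have siB : same_input sB by move=> b n b2; rewrite frB ?siA //; lia.
have siC : same_input sC by move=> b n b2; rewrite frC ?siB //; lia.
have siD : same_input sD by move=> b n b2; rewrite frD ?siC //; lia.
have xB : stores sB 5 gx.
  move=> i a; have := @xcompositionP 5 ca rho s0 rK isT i (enum_rank a).
  by rewrite s0K s0p s0a -/sA frB // => -> //; rewrite ffunE.
have yB : stores sB 6 gy.
  move=> j a; have := @xcompositionP 6 cb rho sA rL isT j (enum_rank a).
  by rewrite !siA // s0L s0p s0b -/sB => -> //; rewrite ffunE.
have st_frame b m (g : 'I_m -> {ffun A -> nat}) s s' :
  (forall n, s' b n = s b n) -> stores s b g -> stores s' b g.
  by move=> E st i a; rewrite E.
pose rows_ok := forall i, exists r,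
  good_match (row_keys h) (label_keys gx gy) i r.
(* [x] and [y] are whatever the output arrays contain; complete matchings are what shows that they
   consist of strategies. *)
pose x := @output_labels A sD oX K; pose y := @output_labels A sD oY L.
have labX : rows_ok -> forall i, exists2 r,
    good_match (row_keys h) (label_keys gx gy) i r & x i = gx r.
  move=> ok i; have [r g] := ok i; exists r => //; apply/ffunP => a.
  rewrite ffunE frD // -xB.
  apply: (@select_tableP oX 5 rK _ sB rho K #|A|) => //; try by rewrite siB ?s0K ?s0p.
  - by lia.
  - by lia.
  - move=> i' i'K; have [r' g'] := ok (Ordinal i'K).
    exists r' => s' rho' fr r1;
      apply: (@row_selectP s' gx gy _ _ _ rho' (Ordinal i'K) r' r1 g').
    + by move=> b n b2; rewrite fr ?siB //; lia.
    + by apply: st_frame xB => n; rewrite fr //; lia.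
    + by apply: st_frame yB => n; rewrite fr //; lia.
  - by move=> rho' r1; apply: (row_selectP siB xB yB r1 g).
have xC : stores sC oX x by move=> i a; rewrite ffunE frD.
have yC : stores sC 6 gy by apply: st_frame yB => n; rewrite frC //; lia.
pose cols_ok := forall j, exists m,
  good_match (column_keys h) (AM_keys x gy) j m.
have labY : cols_ok -> forall j, exists2 m,
    good_match (column_keys h) (AM_keys x gy) j m & y j = gy m.
  move=> ok j; have [m g] := ok j; exists m => //; apply/ffunP => a.
  rewrite ffunE -yC.
  apply: (@select_tableP oY 6 rL _ sC rho L #|A|) => //; try by rewrite siC ?s0L ?s0p.
  - by lia.
  - by lia.
  - move=> j' j'L; have [m' g'] := ok (Ordinal j'L).
    exists m' => s' rho' fr r1;
      apply: (@column_selectP s' x gy _ _ _ rho' (Ordinal j'L) m' r1 g').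
    + by move=> b n b2; rewrite fr ?siC //; lia.
    + by apply: st_frame xC => n; rewrite fr //; lia.
    + by apply: st_frame yC => n; rewrite fr //; lia.
  - by move=> rho' r1; apply: (column_selectP siC xC yC r1 g).
have xD : stores sD oX x by apply: st_frame xC => n; rewrite frD.
have yD : stores sD 6 gy by apply: st_frame yC => n; rewrite frD //; lia.
have x5D : stores sD 5 gx.
  by apply: st_frame xB => n; rewrite frD ?frC //; lia.
have rowsP := row_unmatchedP siD x5D yD rho.
have colsP := column_unmatchedP siD xD yD rho.
have DAV_ok : is_DAV alpha beta h -> rows_ok /\ cols_ok.
  move=> D; have ok : rows_ok by exact: row_match_exists D Bx By.
  split=> //; have [x' [y' D']] := D.
  have xx' : x =1 x'.
    by move=> i; have [r g ->] := labX ok i; exact: row_match_label le_ab D' Bx By g.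
  exact: column_match_exists D' xx' By.
have ok_DAV : rows_ok /\ cols_ok -> DAV_labeling alpha beta h x y.
  move=> [rok cok].
  exact: match_DAV_labeling A0 KE LE Bx By (labX rok) (labY cok).
have out_frame b n : b != 2 -> update sD 2 0
    (xeval sD rho (xnot (XAdd (row_match xunmatched) (column_match xunmatched))))
    b n = sD b n.
  by move=> b2; rewrite /update (negbTE b2).
split.
  exists ((xeval sD rho (row_match xunmatched) == 0) &&
          (xeval sD rho (column_match xunmatched) == 0)).
  split.
    rewrite /output_bit updateE /xnot; xsimp.
    by case: (xeval _ _ (row_match _)) => [|?]; case: (xeval _ _ (column_match _)).
  split=> [/andP[/eqP/rowsP rok /eqP/colsP cok]|/DAV_ok[rok cok]].
    by exists x, y; apply: ok_DAV.
  by apply/andP; split; apply/eqP; [apply/rowsP | apply/colsP].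
move=> /DAV_ok/ok_DAV; apply: eq_DAV_labeling => i; apply/ffunP => a.
  by rewrite !ffunE out_frame //; lia.
by rewrite !ffunE out_frame //; lia.
Qed.

End CoreProgram.

(** * Choice of orientation and the complete algorithm *)

Lemma cards_le_of_size_le (p alpha beta k l : nat) :
  0 < p -> k = 'C(alpha + p - 1, p - 1) -> l = 'C(beta + p - 1, p - 1) ->
  k <= l -> alpha <= beta \/ p <= 1.
Proof.
(* For one candidate both sizes are 1 and tell nothing about the cards; for at least two, the
   binomial is strictly increasing in their number. *)
case: p => [//|[|p]] _ -> ->; first by right.
rewrite subSS subn0 !addnS !subn1 /= => le_kl; left.
rewrite leqNgt; apply/negP => lt_ba; move: le_kl; apply/negP; rewrite -ltnNge.
apply: (@leq_trans 'C((beta + p).+2, p.+1)); last by apply: leq_bin2l; lia.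
by rewrite [in ltnRHS]binS -[X in X < _]addn0 ltn_add2l bin_gt0; lia.
Qed.

Lemma DAV_labeling_tr (A : finType) alpha beta k l (h : 'M[{set A}]_(k, l)) x y :
  DAV_labeling alpha beta h x y -> DAV_labeling beta alpha h^T%R y x.
Proof.
move=> [Bx By hE]; split=> // j i; rewrite mxE hE.
by apply: eq_AM => a; rewrite addnC.
Qed.

Lemma is_DAV_tr (A : finType) alpha beta k l (h : 'M[{set A}]_(k, l)) :
  is_DAV alpha beta h <-> is_DAV beta alpha h^T%R.
Proof.
split=> [[x [y D]]|[y [x D]]]; first by exists y, x; apply: DAV_labeling_tr.
by exists x, y; rewrite -[h]trmxK; apply: DAV_labeling_tr.
Qed.

Definition input_bit (i j a : nat) : xexp :=
  xcell 1 (XAdd (xmul (XVar i) 1) (XVar j)) a.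

(** The guard is nonzero exactly if k > l. Then the voters are exchanged, array 3 still receiving
    the row labels of [h] and array 4 its column labels. *)
Definition algorithm : stmt :=
  SCond (XSub (XGet 0 (XNum 0)) (XGet 0 (XNum 1)))
    (core 1 0 4 3 4 3 (fun i j => input_bit j i))
    (core 0 1 3 4 3 4 input_bit).

Lemma input_bitP (A : finType) (alpha beta k l : nat) (h : 'M[{set A}]_(k, l))
    s (rho : nat -> nat) vi vj va (i : 'I_k) (j : 'I_l) (a : A) :
  same_input (input alpha beta h) s -> 0 < vi -> 0 < vj -> 0 < va ->
  rho vi = i -> rho vj = j -> rho va = enum_rank a ->
  xeval s rho (input_bit vi vj va) = (a \in h i j).
Proof.
move=> si vi0 vj0 va0 ri rj ra; have ne0 v : 0 < v -> (v == 0) = false by case: v.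
have E t : (forall w, 0 < w -> t w = rho w) ->
    xeval s t (XAdd (xmul (XVar vi) 1) (XVar vj)) = i * l + j.
  move=> tE; rewrite /= (eq_bigr (fun=> i : nat)) => [|u _]; last first.
    by rewrite /upd ne0 // tE.
  by rewrite sum_nat_const card_ord (si 0) //= mulnC tE // rj.
rewrite /input_bit xcellE ?ne0 // => [|n]; rewrite !E //; last first.
  by move=> w w0; rewrite /upd ne0.
rewrite !si //= ra; congr nat_of_bool.
apply/existsP/idP => [[i' /existsP[j' /existsP[a' /andP[/eqP E' ha]]]]|ha].
  (* Division with remainder by p, then by l, shows that no other triple has the same address. *)
  have [Ea Eij] : enum_rank a = enum_rank a' :> nat /\ i * l + j = i' * l + j'.
    have lta := ltn_ord (enum_rank a); have lta' := ltn_ord (enum_rank a').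
    have p0 : 0 < #|A| := leq_ltn_trans (leq0n _) lta.
    move: (congr1 (modn^~ #|A|) E') (congr1 (divn^~ #|A|) E').
    by rewrite /= !modnMDl !modn_small // !divnMDl // !divn_small // !addn0.
  have [Ej Ei] : j = j' :> nat /\ i = i' :> nat.
    have l0 : 0 < l := leq_ltn_trans (leq0n _) (ltn_ord j).
    move: (congr1 (modn^~ l) Eij) (congr1 (divn^~ l) Eij).
    by rewrite /= !modnMDl !modn_small // !divnMDl // !divn_small // !addn0.
  by rewrite (val_inj Ei) (val_inj Ej) (enum_rank_inj (val_inj Ea)).
exists i; apply/existsP; exists j; apply/existsP; exists a.
by rewrite eqxx ha.
Qed.

Lemma algorithmP (A : finType) alpha beta k l (h : 'M[{set A}]_(k, l)) rho
    (s1 := sden algorithm rho (input alpha beta h)) :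
  voting_correspondence alpha beta h ->
  (exists b : bool, output_bit s1 = b /\ (b <-> is_DAV alpha beta h)) /\
  (is_DAV alpha beta h -> DAV_labeling alpha beta h
     (@output_labels A s1 3 k) (@output_labels A s1 4 l)).
Proof.
move=> [_ A0 _ kE lE]; rewrite /s1 /algorithm; cbn [sden]; fold sden.
case: ifP; rewrite [xeval _ _ _]/= subn_eq0; last first.
  move=> /negbFE le_kl.
  apply: coreP => //; last exact: cards_le_of_size_le A0 kE lE le_kl.
  by move=> *; apply: (input_bitP (alpha := alpha) (beta := beta)).
rewrite -ltnNge => /ltnW le_lk.
have [[b [bE bD]] lab] : (exists b : bool,
    output_bit (sden (core 1 0 4 3 4 3 (fun i j => input_bit j i)) rho
      (input alpha beta h)) = b /\ (b <-> is_DAV beta alpha h^T%R)) /\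
  (is_DAV beta alpha h^T%R -> DAV_labeling beta alpha h^T%R
     (@output_labels A (sden (core 1 0 4 3 4 3 (fun i j => input_bit j i)) rho
      (input alpha beta h)) 4 l)
     (@output_labels A (sden (core 1 0 4 3 4 3 (fun i j => input_bit j i)) rho
      (input alpha beta h)) 3 k)).
  apply: coreP => //; last by exact: cards_le_of_size_le A0 lE kE le_lk.
  by move=> *; rewrite mxE; apply: (input_bitP (alpha := alpha) (beta := beta)).
split; first by exists b; rewrite is_DAV_tr.
by move=> /is_DAV_tr/lab/DAV_labeling_tr; rewrite trmxK.
Qed.

Lemma algorithm_poly_time : exists (prog : com) (c d : nat),
  forall (A : finType) (alpha beta k l : nat) (h : 'M[{set A}]_(k, l)),
    voting_correspondence alpha beta h ->
    exists (t : nat) (s : state),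
      [/\ exec prog (input alpha beta h) t s,
          t <= c * (k + l + #|A|) ^ d,
          exists b : bool, output_bit s = b /\ (b <-> is_DAV alpha beta h)
        & is_DAV alpha beta h -> DAV_labeling alpha beta h
            (@output_labels A s 3 k) (@output_labels A s 4 l)].
Proof.
have [//|prog [c [d run]]] := @stmt_poly_time algorithm.
exists prog, c, d => A alpha beta k l h vc; have [_ A0 _ _ _] := vc.
have [|//|t [s [ex le si]]] := run (k + l + #|A|) (input alpha beta h).
  split=> [|[|[|[|r]]] //= _]; first by rewrite addn_gt0 A0 orbT.
  - by rewrite -addnA leq_addr.
  - by rewrite -addnA addnCA leq_addr.
  - by rewrite leq_addl.
(* Simulation carries the result over to the machine, as no output lies in the scratch array. *)
have [bit lab] := algorithmP (fun=> 0) vc.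
exists t, s; split=> //; first by rewrite /output_bit si.
move=> /lab; apply: eq_DAV_labeling => i; apply/ffunP => a; rewrite !ffunE si //.
Qed.

(** Both labels of row [i] have the signature read off that row of [h], computed with the same
    reference labels [y]. *)
Lemma row_labels_unique (A : finType) alpha beta k l (h : 'M[{set A}]_(k, l))
    x x' y y' :
  alpha <= beta \/ #|A| <= 1 ->
  DAV_labeling alpha beta h x y -> DAV_labeling alpha beta h x' y' ->
  forall i, x i = x' i.
Proof.
move=> le_ab D D' i; have [[Sx _ _] By _] := D; have [[Sx' _ _] _ _] := D'.
apply: (signature_inj le_ab By) => // a.
by rewrite -(row_keysE D By) -(row_keysE D' By).
Qed.

Theorem theorem3 :
  (* recognition *)
  halts_in_poly_time
    (fun A alpha beta k l h => voting_correspondence alpha beta h)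
    (fun A alpha beta k l h s =>
       exists b : bool, output_bit s = b /\ (b <-> is_DAV alpha beta h))
  /\
  (* construction of a labeling *)
  halts_in_poly_time
    (fun A alpha beta k l h =>
       voting_correspondence alpha beta h /\ is_DAV alpha beta h)
    (fun A alpha beta k l h s =>
       DAV_labeling alpha beta h
         (@output_labels A s 3 k) (@output_labels A s 4 l))
  /\
  (* uniqueness *)
  (forall (A : finType) (alpha beta k l : nat) (h : 'M[{set A}]_(k, l)),
     voting_correspondence alpha beta h ->
     forall (x x' : 'I_k -> {ffun A -> nat}) (y y' : 'I_l -> {ffun A -> nat}),
       DAV_labeling alpha beta h x y ->
       DAV_labeling alpha beta h x' y' ->
       (k <= l -> forall i, x i = x' i) /\
       (l < k -> forall j, y j = y' j)).
Proof.
have [prog [c [d run]]] := algorithm_poly_time.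
split; [|split].
- exists prog, c, d => A alpha beta k l h vc.
  by have [t [s [ex le bit _]]] := run A alpha beta k l h vc; exists t, s.
- exists prog, c, d => A alpha beta k l h [vc D].
  have [t [s [ex le _ lab]]] := run A alpha beta k l h vc.
  by exists t, s; split=> //; apply: lab.
- move=> A alpha beta k l h [_ A0 _ kE lE] x x' y y' D D'.
  split=> [le_kl|/ltnW le_lk].
    exact: row_labels_unique (cards_le_of_size_le A0 kE lE le_kl) D D'.
  exact: row_labels_unique (cards_le_of_size_le A0 lE kE le_lk)
    (DAV_labeling_tr D) (DAV_labeling_tr D').
Qed.
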